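(* Let $T$ be a separating tree on $[n]$. The simple essential lattice congruences $\equiv$ of the weak order on $\mathfrak{S}_n$ for which $T$ is the Hasse diagram of a $\equiv$-poset form an interval $[\equiv_\circ,\equiv_\bullet]$ in the lattice of simple congruences (where $\equiv\ \le\ \equiv'$ iff $\mathcal{A}_\equiv\subseteq\mathcal{A}_{\equiv'}$), where: (1) $\equiv_\circ$ is the congruence for which $\mathcal{A}_n\setminus\mathcal{A}_{\equiv_\circ}$ is the upper ideal of the subarc poset on $\mathcal{A}_n$ generated by all up arcs and down arcs which are not subarcs of any mandatory arc of $T$; (2) $\equiv_\bullet$ is the congruence for which $\mathcal{A}_n\setminus\mathcal{A}_{\equiv_\bullet}$ is the upper ideal of the subarc poset on $\mathcal{A}_n$ generated by the forbidden (up and down) arcs of $T$.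
   Context: Notation: $[n]=\{1,\dots,n\}$ and $]i,j[\,=\{i+1,\dots,j-1\}$ for $i<j$. The weak order on the permutations $\mathfrak{S}_n$ of $[n]$ is the lattice defined by $\sigma\le\tau$ iff $\mathrm{inv}(\sigma)\subseteq\mathrm{inv}(\tau)$, where $\mathrm{inv}(\sigma)=\{(\sigma_p,\sigma_q) : p<q,\ \sigma_p>\sigma_q\}$. A lattice congruence is an equivalence relation $\equiv$ on $\mathfrak{S}_n$ compatible with meets and joins; its classes are intervals. Arcs. An arc is a quadruple $(i,j,A,B)$ with $1\le i<j\le n$ and $A\sqcup B={]i,j[}$; $\mathcal{A}_n$ is the set of all arcs. The up arc is $u(i,j)=(i,j,]i,j[,\varnothing)$ and the down arc is $d(i,j)=(i,j,\varnothing,]i,j[)$. The arc $(i,j,A,B)$ is a subarc of $(i',j',A',B')$ if $i'\le i<j\le j'$, $A\subseteq A'$ and $B\subseteq B'$; this is the order relation of the subarc poset on $\mathcal{A}_n$ (subarcs are smaller). For an arc $\alpha=(i,j,A,B)$ let $\sigma_\alpha$ be the permutation with a single descent whose one-line notation is $1,\dots,i-1$, then the elements of $A$ in increasing order, then $j$, then $i$, then the elements of $B$ in increasing order, then $j+1,\dots,n$. For a lattice congruence $\equiv$, let $\mathcal{A}_\equiv$ be the set of arcs $\alpha$ such that $\sigma_\alpha$ is the minimum of its $\equiv$-class. The map $\equiv\ \mapsto\mathcal{A}_\equiv$ is a bijection from the lattice congruences of the weak order on $\mathfrak{S}_n$ to the arc ideals, i.e. the subsets of $\mathcal{A}_n$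 closed under taking subarcs. The congruence $\equiv$ is essential if $\mathcal{A}_\equiv$ contains all arcs $(i,i+1,\varnothing,\varnothing)$, $i\in[n-1]$. It is simple if every arc of $\mathcal{A}_n\setminus\mathcal{A}_\equiv$ having no strict subarc in $\mathcal{A}_n\setminus\mathcal{A}_\equiv$ is an up arc or a down arc. $\equiv$-posets. A linear extension of a poset $\preccurlyeq$ on $[n]$ is a permutation $\sigma\in\mathfrak{S}_n$ such that $i\preccurlyeq j$ implies $\sigma^{-1}(i)\le\sigma^{-1}(j)$. Each $\equiv$-class is the set of all linear extensions of a unique poset on $[n]$; the posets obtained this way are the $\equiv$-posets. The Hasse diagram of a poset is the directed graph with an edge $i\to j$ for each cover relation $i\prec j$. Separating trees. In a directed tree $T$ (an orientation of a tree), the parents (resp. children) of a node $j$ are the targets of its outgoing edges (resp. the sources of its incoming edges), and the ancestor (resp. descendant) subtrees of $j$ are the connected components of $T\setminus j$ containing its parents (resp. children). A separating tree is a directed tree on $[n]$ in which each node has at most two parents and at most two children, and whenever a node $j$ has two parents (resp. two children), all nodes of one of its two ancestor (resp. descendant) subtrees are smaller than $j$ and all nodes of the other one are larger than $j$. For sets of integers, $L<R$ means that every element of $L$ is smaller than every element of $R$. The mandatory arcs of a separating tree $T$ are the arcs $(i,k,A,B)$ where $i<k$ are the endpoints of an edge of $T$ (in either direction) and $A$ (resp. $B$) is the set of nodes $j\in{]i,k[}$ such that $T$ has a directed path from $j$ to an endpoint of this edge (resp. from an endpoint of this edge to $j$). The forbidden up (resp. down) arcs of $T$ are the arcs $u(\max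 L,\min R)$ (resp. $d(\max L,\min R)$) where $L<R$ are two ancestor (resp. descendant) subtrees of a node of $T$. *)

(* Defs.v *)
From HB Require Import structures.
From mathcomp Require Import all_boot all_fingroup zify.

Set Implicit Arguments.
Unset Strict Implicit.
Unset Printing Implicit Defensive.

(* The ground set [n] = {1, ..., n} is 'I_n = {0, ..., n-1}, with its usual
   order.  A permutation s : 'S_n is read in one-line notation: s p is the
   value in position p, and s^-1 i is the position of the value i. *)

Section WeakOrder.
Variable n : nat.
Implicit Types (s t m : 'S_n) (e : rel 'S_n).

Definition inversions s : {set 'I_n * 'I_n} :=
  [set (s pq.1, s pq.2) | pq : 'I_n * 'I_n & (pq.1 < pq.2) && (s pq.2 < s pq.1)].

Definition weak_le s t : bool := inversions s \subset inversions t.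

Definition is_meet s t m : Prop :=
  [/\ weak_le m s, weak_le m t &
      forall u : 'S_n, weak_le u s -> weak_le u t -> weak_le u m].

Definition is_join s t m : Prop :=
  [/\ weak_le s m, weak_le t m &
      forall u : 'S_n, weak_le s u -> weak_le t u -> weak_le m u].

Definition lattice_congruence e : Prop :=
  [/\ equivalence_rel e,
      forall s s' t t' m m' : 'S_n, e s s' -> e t t' ->
        is_meet s t m -> is_meet s' t' m' -> e m m' &
      forall s s' t t' m m' : 'S_n, e s s' -> e t t' ->
        is_join s t m -> is_join s' t' m' -> e m m'].

End WeakOrder.

Definition between n (i j : 'I_n) : {set 'I_n} := [set k : 'I_n | i < k < j].

Definition is_arc n (q : 'I_n * 'I_n * {set 'I_n} * {set 'I_n}) : bool :=
  let: (i, j, A, B) := q in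
  [&& i < j, A :|: B == between i j & [disjoint A & B]].

Record arc n := Arc {
  arc_quad : 'I_n * 'I_n * {set 'I_n} * {set 'I_n};
  arcP : is_arc arc_quad }.

HB.instance Definition _ n := [isSub for @arc_quad n].
HB.instance Definition _ n := [Finite of arc n by <:].

Section Arcs.
Variable n : nat.
Implicit Types (a b : arc n) (e : rel 'S_n).

Definition arc_src a : 'I_n := let: (i, _, _, _) := arc_quad a in i.
Definition arc_tgt a : 'I_n := let: (_, j, _, _) := arc_quad a in j.
Definition arc_A a : {set 'I_n} := let: (_, _, A, _) := arc_quad a in A.
Definition arc_B a : {set 'I_n} := let: (_, _, _, B) := arc_quad a in B.

Definition is_up_arc a : bool :=
  (arc_A a == between (arc_src a) (arc_tgt a)) && (arc_B a == set0).

Definition is_down_arc a : bool :=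
  (arc_A a == set0) && (arc_B a == between (arc_src a) (arc_tgt a)).

Definition is_basic_arc a : bool := arc_tgt a == (arc_src a).+1 :> nat.

Definition subarc a b : bool :=
  [&& arc_src b <= arc_src a, arc_tgt a <= arc_tgt b,
      arc_A a \subset arc_A b & arc_B a \subset arc_B b].

Definition strict_subarc a b : bool := (a != b) && subarc a b.

Definition upper_ideal (G : {set arc n}) : {set arc n} :=
  [set a | [exists b in G, subarc b a]].

Definition arc_word a : seq 'I_n :=
  [seq k : 'I_n <- enum 'I_n | k < arc_src a] ++
  [seq k : 'I_n <- enum 'I_n | k \in arc_A a] ++
  [:: arc_tgt a; arc_src a] ++
  [seq k : 'I_n <- enum 'I_n | k \in arc_B a] ++
  [seq k : 'I_n <- enum 'I_n | arc_tgt a < k].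

Lemma perm_arc_word a : perm_eq (arc_word a) (enum 'I_n).
Proof.
apply/allP => k _; rewrite /= (count_uniq_mem _ (enum_uniq _)) mem_enum inE.
have cnt (P : pred 'I_n) : count_mem k (filter P (enum 'I_n)) = P k.
  by rewrite (count_uniq_mem _ (filter_uniq _ (enum_uniq _))) mem_filter mem_enum
       andbT.
rewrite /arc_word !count_cat !cnt /=.
case: a => [[[[i j] A] B] H]; rewrite /arc_src /arc_tgt /arc_A /arc_B /=.
move: (H) => /and3P [ltij /eqP AB dAB].
have := disjointFr dAB (x := k); have : (k \in A :|: B) = (i < k < j) by rewrite AB inE.
rewrite inE -!val_eqE /=.
case: (k \in A) => /= [+ /(_ isT) ->|+ _]; first lia.
case: (k \in B) => /=; lia.
Qed.

Lemma size_arc_word a : size (arc_word a) = n.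
Proof. by rewrite (perm_size (perm_arc_word a)) -cardE card_ord. Qed.

Lemma arc_word_inj a :
  injective (fun p : 'I_n => nth (arc_src a) (arc_word a) p).
Proof.
move=> p q /eqP; rewrite nth_uniq ?size_arc_word //.
  by move/eqP/val_inj.
by rewrite (perm_uniq (perm_arc_word a)) enum_uniq.
Qed.

Definition arc_perm a : 'S_n := perm (@arc_word_inj a).

Lemma arc_permE a : [seq arc_perm a p | p <- enum 'I_n] = arc_word a.
Proof.
apply: (@eq_from_nth _ (arc_src a)).
  by rewrite size_map size_arc_word size_enum_ord.
move=> p; rewrite size_map size_enum_ord => ltpn.
by rewrite (nth_map (Ordinal ltpn)) ?size_enum_ord // permE nth_enum_ord.
Qed.

Definition arcs_of e : {set arc n} :=
  [set a | [forall t : 'S_n, e (arc_perm a) t ==> weak_le (arc_perm a) t]].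

Definition essential e : Prop :=
  forall a, is_basic_arc a -> a \in arcs_of e.

Definition simple e : Prop :=
  forall a, a \notin arcs_of e ->
    (forall b, strict_subarc b a -> b \in arcs_of e) ->
    is_up_arc a || is_down_arc a.

End Arcs.

Section Posets.
Variable n : nat.
Implicit Types (r : rel 'I_n) (e : rel 'S_n).

Definition poset r : Prop := [/\ reflexive r, antisymmetric r & transitive r].

Definition linear_extension r (s : 'S_n) : bool :=
  [forall i : 'I_n, forall j : 'I_n,
     r i j ==> ((s^-1)%g i <= (s^-1)%g j)].

Definition congruence_poset e r : Prop :=
  poset r /\ exists s : 'S_n, forall t : 'S_n, e s t = linear_extension r t.

Definition hasse r : rel 'I_n := fun i j =>
  [&& i != j, r i j & [forall k : 'I_n, (r i k && r k j) ==> (k \in [:: i; j])]].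

End Posets.

Section SeparatingTrees.
Variable n : nat.
Implicit Types (T : rel 'I_n) (j p : 'I_n) (L R : {set 'I_n}) (a : arc n).

(* T i j means that there is an edge i -> j. *)
Definition undirected T : rel 'I_n := fun i j => T i j || T j i.

Definition directed_tree T : Prop :=
  [/\ forall i j : 'I_n, T i j -> ~~ T j i,
      forall i j : 'I_n, connect (undirected T) i j &
      forall c : seq 'I_n, 2 < size c -> ~~ ucycleb (undirected T) c].

Definition parents T j : {set 'I_n} := [set p | T j p].
Definition children T j : {set 'I_n} := [set p | T p j].

(* The connected component of p in T \ j, for p != j. *)
Definition component T j p : {set 'I_n} :=
  [set q | connect (fun x y => [&& x != j, y != j & undirected T x y]) p q].

Definition ancestor_subtrees T j : {set {set 'I_n}} :=
  [set component T j p | p in parents T j].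
Definition descendant_subtrees T j : {set {set 'I_n}} :=
  [set component T j p | p in children T j].

Definition set_lt L R : bool :=
  [forall x in L, forall y in R, (x : 'I_n) < (y : 'I_n)].

Definition separated_by j L R : bool :=
  set_lt L [set j] && set_lt [set j] R.

Definition separating_tree T : Prop :=
  [/\ directed_tree T,
      forall j, #|parents T j| <= 2 /\ #|children T j| <= 2,
      forall j p q, p \in parents T j -> q \in parents T j -> p != q ->
        separated_by j (component T j p) (component T j q) ||
        separated_by j (component T j q) (component T j p) &
      forall j p q, p \in children T j -> q \in children T j -> p != q ->
        separated_by j (component T j p) (component T j q) ||
        separated_by j (component T j q) (component T j p)].

Definition mandatory T a : bool :=
  let i := arc_src a in let k := arc_tgt a in
  [&& undirected T i k,
      arc_A a == [set j in between i k | connect T j i || connect T j k] &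
      arc_B a == [set j in between i k | connect T i j || connect T k j]].

Definition is_max L x : bool := (x \in L) && [forall y in L, (y : 'I_n) <= x].
Definition is_min L x : bool := (x \in L) && [forall y in L, x <= (y : 'I_n)].

Definition max_to_min L R a : bool :=
  is_max L (arc_src a) && is_min R (arc_tgt a).

Definition forbidden_up T a : bool :=
  is_up_arc a &&
  [exists j, exists L in ancestor_subtrees T j,
     exists R in ancestor_subtrees T j, set_lt L R && max_to_min L R a].

Definition forbidden_down T a : bool :=
  is_down_arc a &&
  [exists j, exists L in descendant_subtrees T j,
     exists R in descendant_subtrees T j, set_lt L R && max_to_min L R a].

Definition circ_generators T : {set arc n} :=
  [set a | (is_up_arc a || is_down_arc a) &&
           [forall b, mandatory T b ==> ~~ subarc a b]].

Definition bullet_generators T : {set arc n} :=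
  [set a | forbidden_up T a || forbidden_down T a].

(* "e is the congruence whose set of contracted arcs is the upper ideal
   generated by G": e has this property, and is the only congruence that has. *)
Definition the_congruence_contracting (G : {set arc n}) (e : rel 'S_n) : Prop :=
  [/\ lattice_congruence e, ~: arcs_of e = upper_ideal G &
      forall e' : rel 'S_n, lattice_congruence e' ->
        ~: arcs_of e' = upper_ideal G -> e' =2 e].

End SeparatingTrees.

(* Main.v *)
From mathcomp Require Import all_boot all_fingroup zify.
Require Import Defs.

(** The edges of the Hasse diagram of the weak order are labelled by arcs: the
exchange of two adjacent values [i < j] is labelled by the arc from [i] to [j]
that has in its first set the intermediate values standing before [i] and [j], see
[arc_step].  Each such edge is perspective to the edge below the join irreducible
permutation of its arc, so a congruence contracts the edges labelled by an arc
[a] exactly when [a] is not in its arc set ([step_congruence]).  As the classes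
are intervals, they are the connected components of the graph of contracted edges
([congruence_ind]); hence a congruence is determined by its arc set
([congruence_determined]).  Conversely, for an ideal [I] of arcs, being above the
same join irreducible permutations with arc in [I] is a congruence with arc set
[I] ([arcs_of_congr_of]), and every arc set is an ideal ([forcing]).

Fix a separating tree [T].  If [T] is the Hasse diagram of the poset of a class,
this class is the set of linear extensions of [T].  The edges of the weak order
leaving this set exchange the ends of an edge of [T] and are labelled by its
mandatory arcs, all of which occur ([extension_step_edge], [mandatory_step]).
The edges inside this set exchange two incomparable nodes [i] and [k].  Consider
the first turn [v] of the path of [T] from [i] to [k].  If [v] is below [i], it is
before [i] and [k] in the linear extension; the two ancestor subtrees of [v] are
separated by [v], and the points in the gap between them lie below [v], hence
also stand before [i] and [k].  So the label of the edge contains the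
forbidden up arc of this gap, and dually when [v] is above [i]
([extension_step_forbidden]); moreover each forbidden arc occurs as a label
([forbidden_step]).  Therefore the linear extensions of [T] form a class if
and only if all mandatory arcs and no forbidden arcs are in the ideal of the
congruence ([class_of_tree]).

For a simple congruence the first condition says that the ideal contains the up
and down subarcs of mandatory arcs, that is, all arcs whose up and down subarcs
are subarcs of mandatory arcs, and the second one that it avoids the upper ideal
generated by the forbidden arcs ([interval_iff]).  Essentiality is automatic,
because by connectedness some edge of [T] passes over each pair of consecutive
points ([basic_subarc_mandatory]), and the two bounds are comparable because no
forbidden arc is a subarc of a mandatory arc ([forbidden_not_mandatory]). *)

Set Implicit Arguments.
Unset Strict Implicit.
Unset Printing Implicit Defensive.

(** * Permutations as orders on their values *)

Section Before.
Variable n : nat.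
Implicit Types (s t u v : 'S_n) (x y z : 'I_n).

Definition before s x y : bool := (s^-1)%g x < (s^-1)%g y.

Lemma before_irr s x : before s x x = false.
Proof. exact: ltnn. Qed.

Lemma before_trans s x y z : before s x y -> before s y z -> before s x z.
Proof. exact: ltn_trans. Qed.

Lemma before_neg s x y : x != y -> before s x y = ~~ before s y x.
Proof.
move=> neq; rewrite /before; have : (s^-1)%g x != (s^-1)%g y by rewrite (inj_eq perm_inj).
rewrite -val_eqE /=; lia.
Qed.

Lemma before_neq s x y : before s x y -> x != y.
Proof. by apply: contraTneq => ->; rewrite before_irr. Qed.

Lemma before_asym s x y : before s x y -> before s y x = false.
Proof. by rewrite /before; lia. Qed.

Lemma card_before s x : #|[set w | before s w x]| = (s^-1)%g x.
Proof.
have -> : [set w | before s w x] = [set s p | p in [set p : 'I_n | p < (s^-1)%g x]].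
  apply/setP=> w; rewrite inE; apply/idP/imsetP => [lt|[p + ->]].
    by exists ((s^-1)%g w); rewrite ?inE // permKV.
  by rewrite inE /before permK.
rewrite card_imset; last exact: perm_inj.
set k := (s^-1)%g x; have le_kn := ltnW (ltn_ord k).
have -> : [set p : 'I_n | p < k] = [set widen_ord le_kn i | i in 'I_k].
  apply/setP=> p; rewrite inE; apply/idP/imsetP => [lt|[i _ ->] //=].
  by exists (Ordinal lt) => //; apply/val_inj.
by rewrite card_imset ?card_ord // => i j [] /val_inj.
Qed.

Lemma before_ext s t : (forall x y, before s x y -> before t x y) -> s = t.
Proof.
move=> st; suff eqV : (s^-1 = t^-1)%g by rewrite -[s]invgK eqV invgK.
apply/permP=> x; apply/val_inj; rewrite /= -!card_before; congr #|pred_of_set _|.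
apply/setP=> w; rewrite !inE; apply/idP/idP; first exact: st.
case: (eqVneq w x) => [->|neq]; first by rewrite !before_irr.
by apply: contraTT; rewrite -!before_neg 1?eq_sym //; apply: st.
Qed.

Lemma in_inversions s x y : ((x, y) \in inversions s) = (y < x) && before s x y.
Proof.
apply/imsetP/idP => [[[p q]]|/andP[lt b]].
  by rewrite inE /= => /andP[pq lt] [-> ->]; rewrite lt /before !permK.
by exists ((s^-1)%g x, (s^-1)%g y); rewrite ?inE /= ?permKV // lt andbT.
Qed.

Lemma weak_leP s t :
  reflect (forall x y, y < x -> before s x y -> before t x y) (weak_le s t).
Proof.
apply: (iffP subsetP) => [st x y lt b|st [x y]].
  by have := st (x, y); rewrite !in_inversions lt b => /(_ isT).
by rewrite !in_inversions => /andP[lt b]; rewrite lt (st x y).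
Qed.

Lemma weak_le_refl s : weak_le s s.
Proof. exact: subxx. Qed.

Lemma weak_le_trans s t u : weak_le s t -> weak_le t u -> weak_le s u.
Proof. exact: subset_trans. Qed.

(** Send each value to the number of values before it. *)
Lemma perm_of_order (lt : rel 'I_n) :
  irreflexive lt -> transitive lt -> (forall x y, x != y -> lt x y || lt y x) ->
  exists s, before s =2 lt.
Proof.
move=> irr tr tot.
pose g x := #|[set w | lt w x]|.
have gn x : g x < n.
  rewrite -[X in _ < X](card_ord n) -cardsT; apply: proper_card.
  by apply/properP; split; [exact: subsetT|exists x; rewrite ?inE ?irr].
have gmono x y : lt x y -> g x < g y.
  move=> xy; apply/proper_card/properP; split.
    by apply/subsetP=> w; rewrite !inE => /tr; apply.
  by exists x; rewrite !inE ?irr.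
have ginj : injective (fun x => Ordinal (gn x)).
  move=> x y [] eqg; apply/eqP; apply: contraT => /tot /orP[] /gmono; lia.
exists ((perm ginj)^-1)%g => x y; rewrite /before invgK !permE /=.
apply/idP/idP => [lg|]; last exact: gmono.
have neq : x != y by apply: contraTneq lg => ->; rewrite ltnn.
by case/orP: (tot _ _ neq) => // /gmono; lia.
Qed.

Lemma perm_of_rank (g : 'I_n -> nat) : injective g ->
  exists s, forall x y, before s x y = (g x < g y).
Proof.
move=> ginj; apply: perm_of_order => [x|y x z|x y neq]; first exact: ltnn.
  exact: ltn_trans.
by rewrite -neq_ltn (inj_eq ginj).
Qed.

(** Reversal of the one-line notation, an anti-automorphism of the weak order. *)
Definition rev_perm s : 'S_n := (perm (@rev_ord_inj n) * s)%g.

Lemma before_rev s x y : before (rev_perm s) x y = before s y x.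
Proof.
have pos z : ((rev_perm s)^-1)%g z = rev_ord ((s^-1)%g z).
  apply: (@perm_inj _ (rev_perm s)).
  by rewrite permKV permM permE rev_ordK permKV.
rewrite /before !pos /=; have := ltn_ord ((s^-1)%g x); have := ltn_ord ((s^-1)%g y); lia.
Qed.

Lemma rev_permK : involutive rev_perm.
Proof. by move=> s; apply: before_ext => x y; rewrite !before_rev. Qed.

Lemma weak_le_rev s t : weak_le (rev_perm s) (rev_perm t) = weak_le t s.
Proof.
have imp u v : weak_le v u -> weak_le (rev_perm u) (rev_perm v).
  move=> /weak_leP vu; apply/weak_leP => x y lt; rewrite !before_rev => b.
  by have neq := before_neq b; move: b; rewrite !(before_neg _ neq); apply: contra; apply: vu.
by apply/idP/idP => [/imp|/imp //]; rewrite !rev_permK.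
Qed.

Lemma is_join_rev s t m : is_meet s t m -> is_join (rev_perm s) (rev_perm t) (rev_perm m).
Proof.
by case=> ms mt mm; split=> [||u]; rewrite ?weak_le_rev // -[u]rev_permK !weak_le_rev; apply: mm.
Qed.

Lemma is_meet_rev s t m : is_join s t m -> is_meet (rev_perm s) (rev_perm t) (rev_perm m).
Proof.
by case=> ms mt mm; split=> [||u]; rewrite ?weak_le_rev // -[u]rev_permK !weak_le_rev; apply: mm.
Qed.

(** * The weak order is a lattice *)

(** The inversion set of the join is the transitive closure of the union of the
two inversion sets: a value lying between the ends of a chain of inversions
splits one link of the chain, hence the complement is transitive too. *)
Lemma join_exists s t : exists m, is_join s t m.
Proof.
pose R x y := (y < x) && (before s x y || before t x y).
have Rle x y : connect R x y -> y <= x.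
  case/connectP=> p; elim: p x => [|z p IH] x /=; first by move=> _ ->.
  by case/andP=> /andP[lt _] /IH /[apply]; lia.
have co x y z : connect R x y -> y < z -> z < x -> connect R x z || connect R z y.
  case/connectP=> p; elim: p x => [|w p IH] x /=; first by move=> _ ->; lia.
  case/andP=> xw pth yl yz zx; case: (ltngtP z w) => [zw|wz|/val_inj ->].
  - case/orP: (IH w pth yl yz zw) => [wz|->]; last by rewrite orbT.
    by rewrite (connect_trans (connect1 xw) wz).
  - have wy : connect R w y by apply/connectP; exists p.
    have key u : before u x w -> before u x z || before u z w.
      move=> b; case: (eqVneq x z) => [eq|neq]; first by rewrite eq ltnn in zx.
      case: (boolP (before u x z)) => //= nb; apply: before_trans b.
      by rewrite before_neg 1?eq_sym.
    have : R x z || R z w.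
      rewrite /R zx wz /=; case/andP: xw => _ /orP[] /key /orP[] ->; by rewrite ?orbT.
    case/orP => [/connect1 ->//|zw].
    by rewrite (connect_trans (connect1 zw) wy) orbT.
  - by rewrite (connect1 xw).
pose lt x y := if y < x then connect R x y else (x < y) && ~~ connect R y x.
have [m bm] : exists m, before m =2 lt.
  apply: perm_of_order => [x|y x z|x y].
  - by rewrite /lt ltnn.
  - have tr a b c : connect R a b -> connect R b c -> connect R a c by apply: connect_trans.
    rewrite /lt.
    case: (ltngtP y x) => [yx|xy|/val_inj <-] //;
    case: (ltngtP z y) => [zy|yz|/val_inj <-] //=;
    case: (ltngtP z x) => [zx|xz|/val_inj eq] //=; try lia;
    try by have := congr1 val eq; rewrite /=; lia.
    + exact: tr.
    + by move=> cxy /negP nzy; case/orP: (co _ _ _ cxy yz zx) => // /nzy.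
    + by move=> cxy nzy; apply: contra nzy => /tr; apply.
    + by rewrite eq => ->.
    + by move=> nyx cyz; case/orP: (co _ _ _ cyz zx xy) => // cyx; rewrite cyx in nyx.
    + by move=> nyx cyz; apply: contra nyx; apply: tr.
    + by rewrite eq => /negP nyx /nyx.
    + move=> nyx nzy; apply/negP => czx.
      by case/orP: (co _ _ _ czx xy yz) => c; rewrite c in nyx nzy.
  - by rewrite -val_eqE /lt /=; case: (ltngtP x y) => //= _ _; case: connect.
have mE x y : y < x -> before m x y = connect R x y by move=> yx; rewrite bm /lt yx.
exists m; split.
- by apply/weak_leP => x y yx b; rewrite mE // connect1 // /R yx b.
- by apply/weak_leP => x y yx b; rewrite mE // connect1 // /R yx b orbT.
move=> u /weak_leP su /weak_leP tu; apply/weak_leP => x y yx; rewrite mE // => c.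
have : (x == y) || before u x y; last by case/orP=> // /eqP eq; rewrite eq ltnn in yx.
have R1 a b : R a b -> before u a b by case/andP=> ba /orP[]; [exact: su|exact: tu].
case/connectP: c => p; elim: p x {yx} => [|z p IH] x /=; first by move=> _ ->; rewrite eqxx.
case/andP=> /R1 xz pth yl; case/orP: (IH z pth yl) => [/eqP <-|zy]; first by rewrite xz orbT.
by rewrite (before_trans xz zy) orbT.
Qed.

Lemma meet_exists s t : exists m, is_meet s t m.
Proof.
have [m jm] := join_exists (rev_perm s) (rev_perm t).
by exists (rev_perm m); have := is_meet_rev jm; rewrite !rev_permK.
Qed.

End Before.

(** * Arcs *)

Section ArcsAndSteps.
Variable n : nat.
Implicit Types (s t u v : 'S_n) (x y z c p q : 'I_n) (a b : arc n).

Lemma arc_quadE a : is_arc (arc_src a, arc_tgt a, arc_A a, arc_B a).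
Proof. by case: a => [[[[i j] A] B] H]. Qed.

Lemma arc_lt a : arc_src a < arc_tgt a.
Proof. by case/and3P: (arc_quadE a). Qed.

Lemma arc_AUB a : arc_A a :|: arc_B a = between (arc_src a) (arc_tgt a).
Proof. by case/and3P: (arc_quadE a) => _ /eqP. Qed.

Lemma in_arc_between a c : arc_src a < c < arc_tgt a = (c \in arc_A a) || (c \in arc_B a).
Proof. by rewrite -in_setU arc_AUB inE. Qed.

Lemma arc_AB a c : c \in arc_A a -> c \in arc_B a = false.
Proof. by case/and3P: (arc_quadE a) => _ _ /disjointFr; apply. Qed.

Lemma in_arc_B a c : arc_src a < c < arc_tgt a -> (c \in arc_B a) = (c \notin arc_A a).
Proof.
rewrite in_arc_between; case: (boolP (c \in arc_A a)) => [/arc_AB ->|_] //=.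
Qed.

Lemma in_arc_A_between a c : c \in arc_A a -> arc_src a < c < arc_tgt a.
Proof. by rewrite in_arc_between => ->. Qed.

Lemma in_arc_B_between a c : c \in arc_B a -> arc_src a < c < arc_tgt a.
Proof. by rewrite in_arc_between orbC => ->. Qed.

Lemma is_arc_cut x y (P : pred 'I_n) : x < y ->
  is_arc (x, y, [set c in between x y | P c], [set c in between x y | ~~ P c]).
Proof.
move=> xy; rewrite /is_arc xy /=; apply/andP; split.
  by apply/eqP/setP=> c; rewrite !inE -andb_orr orbN andbT.
rewrite disjoints_subset; apply/subsetP=> c.
by rewrite !inE negb_and negbK => /andP[_ ->]; rewrite orbT.
Qed.

Definition cut_arc x y (xy : x < y) (P : pred 'I_n) : arc n := Arc (is_arc_cut P xy).

Lemma in_cut_arc x y (xy : x < y) (P : pred 'I_n) c :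
  (c \in arc_A (cut_arc xy P)) = (x < c < y) && P c.
Proof. by rewrite /arc_A /= !inE. Qed.

Lemma arc_ext a b : arc_src a = arc_src b -> arc_tgt a = arc_tgt b ->
  (forall c, arc_src a < c < arc_tgt a -> (c \in arc_A a) = (c \in arc_A b)) -> a = b.
Proof.
move=> es et eA.
have AE : arc_A a = arc_A b.
  apply/setP=> c; apply/idP/idP => cA; first by rewrite -eA // in_arc_A_between.
  by rewrite eA // es et in_arc_A_between.
have BE : arc_B a = arc_B b.
  apply/setP=> c; apply/idP/idP => cB; have := in_arc_B_between cB.
    by rewrite es et => bt; rewrite in_arc_B // -AE -in_arc_B // es et.
  by rewrite -es -et => bt; rewrite in_arc_B // AE -in_arc_B // -es -et.
apply: val_inj; move: es et AE BE.
case: a {eA} => [[[[i j] A] B] ?]; case: b => [[[[i' j'] A'] B'] ?] /=.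
by rewrite /arc_src /arc_tgt /arc_A /arc_B /= => -> -> -> ->.
Qed.

Lemma subarc_refl a : subarc a a.
Proof. by rewrite /subarc !leqnn !subxx. Qed.

Lemma subarc_trans a b d : subarc a b -> subarc b d -> subarc a d.
Proof.
move=> /and4P[s1 t1 A1 B1] /and4P[s2 t2 A2 B2]; apply/and4P; split.
- exact: leq_trans s2 s1.
- exact: leq_trans t1 t2.
- exact: subset_trans A1 A2.
- exact: subset_trans B1 B2.
Qed.

Lemma subarcP a b :
  reflect ([/\ arc_src b <= arc_src a, arc_tgt a <= arc_tgt b &
            forall c, arc_src a < c < arc_tgt a -> (c \in arc_A a) = (c \in arc_A b)])
          (subarc a b).
Proof.
apply: (iffP and4P) => [[ss tt /subsetP sA /subsetP sB]|[ss tt sA]].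
  split=> // c ct; apply/idP/idP => [/sA //|]; apply: contraLR.
  by rewrite -in_arc_B // => /sB cB; rewrite -in_arc_B // in_arc_B_between.
split=> //; apply/subsetP=> c cX.
  by rewrite -sA // in_arc_A_between.
have ct := in_arc_B_between cX.
rewrite in_arc_B -?(sA _ ct) -?in_arc_B //; lia.
Qed.

(** * Steps of the weak order *)

(** The cover relations of the weak order, labelled by arcs.  The two
exchanged values are adjacent, because a value standing between them would close
a cycle in the order of [t], see [step_src]. *)
Definition arc_step a s t : Prop :=
  [/\ before s (arc_src a) (arc_tgt a),
      forall x y, before t x y = ((x, y) == (arc_tgt a, arc_src a)) ||
                    before s x y && ((x, y) != (arc_src a, arc_tgt a)) &
      forall c, arc_src a < c < arc_tgt a -> (c \in arc_A a) = before s c (arc_tgt a)].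

Lemma step_src a s t c : arc_step a s t -> c != arc_src a -> c != arc_tgt a ->
  before s c (arc_src a) = before s c (arc_tgt a).
Proof.
case=> bij tE _ ci cj; apply/idP/idP => [b|b]; first exact: before_trans b bij.
rewrite (before_neg _ ci); apply/negP => b'.
have := before_irr t (arc_src a); rewrite (@before_trans _ t _ c) //; last first.
  apply: (@before_trans _ t _ (arc_tgt a)); rewrite tE ?eqxx //.
  by rewrite b !xpair_eqE (negPf ci) orbT.
by rewrite tE b' !xpair_eqE (negPf cj) andbF orbT.
Qed.

Lemma step_le a s t : arc_step a s t -> weak_le s t.
Proof.
case=> bij tE _; apply/weak_leP=> x y yx b; rewrite tE b; apply/orP; right.
by apply: contraTneq yx => -[-> ->]; rewrite -leqNgt ltnW ?arc_lt.
Qed.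

Lemma step_before a s t : arc_step a s t -> before t (arc_tgt a) (arc_src a).
Proof. by case=> _ tE _; rewrite tE eqxx. Qed.

Lemma step_nle a s t : arc_step a s t -> ~~ weak_le t s.
Proof.
move=> st; apply/negP => /weak_leP /(_ _ _ (arc_lt a) (step_before st)).
by case: st => /before_asym ->.
Qed.

(** Transport the order of [s] along the transposition [f] of [x] and [y]. *)
Lemma swap_exists s x y : before s x y -> (forall c, before s x c -> ~~ before s c y) ->
  exists t, forall p q, before t p q = ((p, q) == (y, x)) || before s p q && ((p, q) != (x, y)).
Proof.
move=> xy adj.
have adj' c : c != x -> c != y -> before s x c = before s y c.
  move=> cx cy; apply/idP/idP => [/adj|]; last exact: before_trans.
  by rewrite (@before_neg _ s y c) 1?eq_sym.
have adj2 c : c != x -> c != y -> before s c x = before s c y.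
  by move=> cx cy; rewrite (before_neg _ cx) (before_neg _ cy) adj'.
pose f z := if z == x then y else if z == y then x else z.
have fK : involutive f.
  move=> z; rewrite /f; case: (eqVneq z x) => [->|zx].
    by rewrite eqxx; case: eqP => // ->.
  case: (eqVneq z y) => [->|zy]; first by rewrite eqxx.
  by rewrite (negPf zx) (negPf zy).
have [t tE] : exists t, before t =2 fun p q => before s (f p) (f q).
  apply: perm_of_order => [p|q p w|p q neq]; first exact: before_irr.
    exact: before_trans.
  have neq' : f p != f q by rewrite (inj_eq (inv_inj fK)).
  by rewrite (before_neg _ neq') orNb.
exists t => p q; rewrite tE /f !xpair_eqE; have neq := before_neq xy.
case: (eqVneq p x) => [->|px]; case: (eqVneq q x) => [->|qx] //=.
all: try rewrite (negPf neq); try rewrite [y == x]eq_sym (negPf neq).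
all: try (case: (eqVneq p y) => [->|py] //=); try (case: (eqVneq q y) => [->|qy] //=).
all: rewrite ?before_irr ?eqxx ?andbT ?andbF ?orbF ?xy ?(before_asym xy) ?adj' ?adj2 //=.
Qed.

Lemma step_exists s x y : before s x y -> (forall c, before s x c -> ~~ before s c y) ->
  exists a t, [/\ forall p q, before t p q = ((p, q) == (y, x)) ||
                                before s p q && ((p, q) != (x, y)) &
    if x < y then [/\ arc_src a = x, arc_tgt a = y & arc_step a s t]
             else [/\ arc_src a = y, arc_tgt a = x & arc_step a t s]].
Proof.
move=> xy adj; have [t tE] := swap_exists xy adj.
case: (ltngtP x y) => [lt|lt|/val_inj eq]; last by rewrite eq before_irr in xy.
  exists (cut_arc lt (fun c => before s c y)), t; split=> //; split=> //; split=> // c ct.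
  by rewrite in_cut_arc ct.
exists (cut_arc lt (fun c => before t c x)), t; split=> //; split=> //; split=> [|p q|c ct].
- by rewrite tE eqxx.
- rewrite tE /arc_src /arc_tgt /=.
  case: (eqVneq (p, q) (x, y)) => [[-> ->]|neq] /=; first by rewrite xy.
  case: (eqVneq (p, q) (y, x)) => [[-> ->]|neq'] /=; last by rewrite !andbT.
  by rewrite (before_asym xy).
- by rewrite in_cut_arc ct.
Qed.

(** Among the pairs on which [s] and [t] disagree, take one that is closest in [s]. *)
Lemma adjacent_discordant s t : s != t ->
  exists x y, [/\ before s x y, before t y x & forall c, before s x c -> ~~ before s c y].
Proof.
move=> st.
have [x [y [xy yx]]] : exists x y, before s x y /\ before t y x.
  have : ~~ [forall x, forall y, before s x y ==> before t x y].
    apply: contra st => /forallP st; apply/eqP/before_ext => x y.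
    by have /forallP/(_ y)/implyP := st x.
  case/forallPn => x /forallPn [y]; rewrite negb_imply => /andP[b nb].
  by exists x, y; split=> //; rewrite before_neg // eq_sym (before_neq b).
have [m] := ubnP #|[set c | before s x c && before s c y]|.
elim: m x y xy yx => // m IH x y xy yx lm.
case: (pickP (fun c => before s x c && before s c y)) => [c /andP[xc cy]|none]; last first.
  exists x, y; split=> // c xc; apply/negP => cy; by have := none c; rewrite xc cy.
case: (boolP (before t c x)) => [cx|ncx].
  apply: (IH x c) => //; rewrite ltnS in lm; apply: leq_trans lm; apply: proper_card.
  apply/properP; split; last by exists c; rewrite !inE ?xc ?cy ?before_irr ?andbF.
  by apply/subsetP=> d; rewrite !inE => /andP[-> dc]; rewrite (before_trans dc cy).
apply: (IH c y) => //.
  by apply: before_trans yx _; rewrite (before_neg _ (before_neq xc)).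
rewrite ltnS in lm; apply: leq_trans lm; apply: proper_card.
apply/properP; split; last by exists c; rewrite !inE ?xc ?cy ?before_irr.
by apply/subsetP=> d; rewrite !inE => /andP[cd ->]; rewrite (before_trans xc cd).
Qed.

(** The permutations on the shortest paths of steps from [s] to [t]; for [s] below
[t], the interval between them. *)
Definition in_hull s t u : Prop := forall x y, before s x y -> before t x y -> before u x y.

Lemma hull_interval s t u : weak_le s t -> in_hull s t u -> weak_le s u /\ weak_le u t.
Proof.
move=> /weak_leP st hu; split; apply/weak_leP => x y yx b; first by apply: hu => //; apply: st.
have neq := before_neq b; rewrite (before_neg _ neq); apply/negP => byx.
suff : before u y x by rewrite (before_asym b).
apply: hu => //; rewrite before_neg 1?eq_sym //; apply/negP => /(st _ _ yx).
by rewrite (before_asym byx).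
Qed.

(** Exchanging two adjacent values of one permutation on which the other one
disagrees brings it closer to the other one, inside the hull. *)
Lemma hull_ind (P : 'S_n -> Prop) s t :
  (forall u v a, in_hull s t u -> in_hull s t v -> arc_step a u v \/ arc_step a v u ->
     P u -> P v) ->
  P s -> P t.
Proof.
move=> stepP; suff gen u : in_hull s t u -> P u -> P t by exact: gen.
pose d u := [set p | before u p.1 p.2 && before t p.2 p.1].
have [m] := ubnP #|d u|; elim: m u => // m IH u lm hu Pu; case: (eqVneq u t) => [<- //|neq].
have [x [y [xy yx adj]]] := adjacent_discordant neq.
have [a [v [vE av]]] := step_exists xy adj.
have hv : in_hull s t v.
  move=> p q sp tp; rewrite vE (hu p q sp tp); apply/orP; right.
  by apply: contraTneq tp => -[-> ->]; rewrite (before_asym yx).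
apply: (IH v _ hv); last first.
  apply: (stepP u v a hu hv) => //; case: (ltnP x y) av => _ [_ _]; by [left|right].
rewrite ltnS in lm; apply: leq_trans lm; apply: proper_card; apply/properP; split.
  apply/subsetP=> [[p q]]; rewrite !inE /= vE => /andP[/orP[/eqP [-> ->]|/andP[-> _]]] //.
  by rewrite (before_asym yx).
exists (x, y); rewrite !inE /= ?xy ?yx // vE eqxx andbF orbF andbT xpair_eqE.
by rewrite (negPf (before_neq xy)).
Qed.

End ArcsAndSteps.

(** * Join irreducible permutations *)

Section ArcPermutations.
Variable n : nat.
Implicit Types (x y z c p q : 'I_n) (a b : arc n).

(** The word of [arc_perm a] consists of increasing blocks, in which the only
points placed before smaller ones are the target of [a] and the points of
[arc_A a], and the only points placed after larger ones are the source of [a]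
and the points of [arc_B a]. *)
Lemma arc_perm_inv a x y : y < x ->
  before (arc_perm a) x y =
    ((x == arc_tgt a) || (x \in arc_A a)) && ((y == arc_src a) || (y \in arc_B a)).
Proof.
set w := arc_word a.
have uw : uniq w by rewrite (perm_uniq (perm_arc_word a)) enum_uniq.
have mw z : z \in w by rewrite (perm_mem (perm_arc_word a)) mem_enum.
have posE z : ((arc_perm a)^-1)%g z = index z w :> nat.
  rewrite -[in RHS](permKV (arc_perm a) z) [in RHS]permE index_uniq //.
  by rewrite size_arc_word ltn_ord.
(* [arc_word a] is sorted by block, then by value. *)
pose key c := if c < arc_src a then 0 else if c \in arc_A a then 1
  else if c == arc_tgt a then 2 else if c == arc_src a then 3
  else if c \in arc_B a then 4 else 5.
pose R x y := (key x < key y) || (key x == key y) && (x < y).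
have Rtr : transitive R by move=> q p r; rewrite /R; lia.
have facts z : arc_src a < z < arc_tgt a = (z \in arc_A a) || (z \in arc_B a) /\
    ~~ ((z \in arc_A a) && (z \in arc_B a)).
  by split; [exact: in_arc_between|apply/negP => /andP[/arc_AB ->]].
have lt := arc_lt a.
have sf (P : pred 'I_n) k : (forall z, P z -> key z = k) -> pairwise R (filter P (enum 'I_n)).
  move=> Pk; have : pairwise (fun p q : 'I_n => p < q) (filter P (enum 'I_n)).
    rewrite pairwise_filter // -(pairwise_map val ltn) val_enum_ord.
    by rewrite -sorted_pairwise ?iota_ltn_sorted //; apply: ltn_trans.
  apply: (@sub_in_pairwise _ P); last exact: filter_all.
  by move=> p q /Pk kp /Pk kq; rewrite /R kp kq eqxx => ->; rewrite orbT.
have sw : pairwise R w.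
  have k0 z : z < arc_src a -> key z = 0 by rewrite /key => ->.
  have k1 z : z \in arc_A a -> key z = 1.
    by move=> zA; have [f1 f2] := facts z; rewrite /key -!val_eqE /=; repeat (case: ifP); lia.
  have k2 : key (arc_tgt a) = 2.
    by have [f1 f2] := facts (arc_tgt a); rewrite /key -!val_eqE /=; repeat (case: ifP); lia.
  have k3 : key (arc_src a) = 3.
    by have [f1 f2] := facts (arc_src a); rewrite /key -!val_eqE /=; repeat (case: ifP); lia.
  have k4 z : z \in arc_B a -> key z = 4.
    by move=> zB; have [f1 f2] := facts z; rewrite /key -!val_eqE /=; repeat (case: ifP); lia.
  have k5 z : arc_tgt a < z -> key z = 5.
    by move=> zl; have [f1 f2] := facts z; rewrite /key -!val_eqE /=; repeat (case: ifP); lia.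
  have ar k l xs ys : k < l -> all (fun z => key z == k) xs ->
      all (fun z => key z == l) ys -> allrel R xs ys.
    move=> kl /allP xk /allP yl; apply/allrelP => p q /xk /eqP kp /yl /eqP kq.
    by rewrite /R kp kq kl.
  have af (P : pred 'I_n) k : (forall z, P z -> key z = k) ->
      all (fun z => key z == k) (filter P (enum 'I_n)).
    by move=> Pk; apply/allP=> z; rewrite mem_filter => /andP[/Pk -> _].
  have a0 := af _ _ k0; have a1 := af _ _ k1; have a4 := af _ _ k4; have a5 := af _ _ k5.
  have a2 : all (fun z => key z == 2) [:: arc_tgt a] by rewrite /= k2.
  have a3 : all (fun z => key z == 3) [:: arc_src a] by rewrite /= k3.
  rewrite /w /arc_word -[[:: arc_tgt a; _]]/([:: arc_tgt a] ++ [:: arc_src a]) -catA.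
  rewrite !pairwise_cat !allrel_catr.
  rewrite (ar _ _ _ _ _ a0 a1) // (ar _ _ _ _ _ a0 a2) // (ar _ _ _ _ _ a0 a3) //.
  rewrite (ar _ _ _ _ _ a0 a4) // (ar _ _ _ _ _ a0 a5) // (ar _ _ _ _ _ a1 a2) //.
  rewrite (ar _ _ _ _ _ a1 a3) // (ar _ _ _ _ _ a1 a4) // (ar _ _ _ _ _ a1 a5) //.
  rewrite (ar _ _ _ _ _ a2 a3) // (ar _ _ _ _ _ a2 a4) // (ar _ _ _ _ _ a2 a5) //.
  rewrite (ar _ _ _ _ _ a3 a4) // (ar _ _ _ _ _ a3 a5) // (ar _ _ _ _ _ a4 a5) //.
  by rewrite (sf _ _ k0) (sf _ _ k1) (sf _ _ k4) (sf _ _ k5).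
have RE x' y' : (index x' w < index y' w) = R x' y'.
  have imp p q : index p w < index q w -> R p q.
    by apply: sorted_ltn_index => //; rewrite sorted_pairwise.
  apply/idP/idP; first exact: imp.
  apply: contraTT; rewrite -leqNgt leq_eqVlt => /orP[/eqP eq|/imp]; last by rewrite /R; lia.
  have -> : y' = x' by rewrite -(nth_index x' (mw y')) eq nth_index.
  by rewrite /R; lia.
move=> yx; rewrite /before !posE RE /R /key.
have [x1 x2] := facts x; have [y1 y2] := facts y; rewrite -!val_eqE /=.
by repeat (case: ifP); lia.
Qed.
End ArcPermutations.

Section Congruences.
Variable n : nat.
Implicit Types (s t u v m : 'S_n) (x y z c p q : 'I_n) (a b : arc n) (e : rel 'S_n).
Implicit Types (I : {set arc n}).

Lemma step_inv a s t x y : arc_step a s t -> y < x ->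
  before t x y = ((x, y) == (arc_tgt a, arc_src a)) || before s x y.
Proof.
case=> _ tE _ yx; rewrite tE; have -> : (x, y) != (arc_src a, arc_tgt a).
  by apply: contraTneq yx => -[-> ->]; have := arc_lt a; lia.
by rewrite andbT.
Qed.

(** [arc_perm a] is the smallest permutation at the top of a step labelled [a]. *)
Lemma step_arc_perm_le a s t : arc_step a s t -> weak_le (arc_perm a) t.
Proof.
move=> st; have [_ tE sA] := st; apply/weak_leP=> x y yx.
rewrite arc_perm_inv // => /andP[xP yP].
have bx : (x == arc_tgt a) || before t x (arc_tgt a).
  case/orP: xP => [->//|xA]; have ct := in_arc_A_between xA; rewrite orbC tE -sA // xA.
  by rewrite !xpair_eqE -!val_eqE /=; lia.
have byy : (y == arc_src a) || before t (arc_src a) y.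
  case/orP: yP => [->//|yB]; have ct := in_arc_B_between yB; rewrite orbC tE.
  have -> : before s (arc_src a) y.
    rewrite before_neg -?val_eqE /=; last by lia.
    rewrite (step_src st) -?val_eqE -?sA -?in_arc_B //=; lia.
  by rewrite !xpair_eqE -!val_eqE /=; lia.
have ji := step_before st.
case/orP: bx => [/eqP -> |bx]; case/orP: byy => [/eqP -> //|byy].
- exact: before_trans ji byy.
- exact: before_trans bx ji.
- exact: before_trans bx (before_trans ji byy).
Qed.

Lemma arc_perm_src_tgt a : before (arc_perm a) (arc_tgt a) (arc_src a).
Proof. by rewrite arc_perm_inv ?arc_lt // !eqxx. Qed.

(** The descent of [arc_perm a] is the exchange of the ends of [a]. *)
Lemma arc_perm_step a : exists s, arc_step a s (arc_perm a).
Proof.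
have lt := arc_lt a.
have inA c : arc_src a < c < arc_tgt a -> before (arc_perm a) c (arc_tgt a) = (c \in arc_A a).
  move=> ct; rewrite before_neg ?arc_perm_inv -?val_eqE /=; try lia.
  by rewrite eqxx in_arc_B //; case: (c \in arc_A a) => //=; lia.
have [] := @step_exists n (arc_perm a) (arc_tgt a) (arc_src a).
- exact: arc_perm_src_tgt.
- move=> c jc; apply/negP => ci.
  have cj : c < arc_tgt a.
    rewrite ltnNge leq_eqVlt; apply/negP => /orP[/eqP/val_inj eq|cj].
      by rewrite eq before_irr in jc.
    rewrite arc_perm_inv 1?(ltn_trans lt) // -!val_eqE /= in ci.
    by case/andP: ci => /orP[|/in_arc_A_between]; lia.
  have ic : arc_src a < c.
    rewrite ltnNge leq_eqVlt; apply/negP => /orP[/eqP/val_inj eq|ic].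
      by rewrite eq before_irr in ci.
    rewrite arc_perm_inv // -!val_eqE /= in jc.
    by case/andP: jc => _ /orP[|/in_arc_B_between]; lia.
  rewrite arc_perm_inv // -!val_eqE /= in jc; rewrite arc_perm_inv // -!val_eqE /= in ci.
  case/andP: ci => /orP[|cA] => [|_]; first lia.
  by case/andP: jc => _ /orP[|]; [lia|rewrite (arc_AB cA)].
move=> b [s [sE]]; rewrite ltnNge ltnW //= => -[es et st]; exists s.
suff eqb : b = a by rewrite eqb in st.
apply: arc_ext => // c; rewrite es et => ct; case: (st) => _ _ ->; last by rewrite es et.
rewrite et -inA // sE !xpair_eqE -!val_eqE /=; lia.
Qed.

(** The other inversions of [arc_perm a] are forced by transitivity. *)
Lemma below_arc_perm a m : weak_le m (arc_perm a) -> before m (arc_tgt a) (arc_src a) ->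
  weak_le (arc_perm a) m.
Proof.
move=> /weak_leP ma ji; apply/weak_leP => x y yx.
have lt := arc_lt a.
rewrite arc_perm_inv // => /andP[xP yP].
have bx : (x == arc_tgt a) || before m x (arc_tgt a).
  case/orP: xP => [->//|xA]; have /andP[ix xj] := in_arc_A_between xA; apply/orP; right.
  rewrite before_neg -?val_eqE /= ?ltn_eqF //; apply/negP => /(ma _ _ xj).
  by rewrite arc_perm_inv // (arc_AB xA) -!val_eqE /=; lia.
have byy : (y == arc_src a) || before m (arc_src a) y.
  case/orP: yP => [->//|yB]; have /andP[iy yj] := in_arc_B_between yB; apply/orP; right.
  rewrite before_neg -?val_eqE /= ?ltn_eqF //; apply/negP => /(ma _ _ iy).
  rewrite arc_perm_inv // -!val_eqE /=; have := @arc_AB _ a y; rewrite yB.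
  by case: (y \in arc_A a) => [/(_ isT)//|_]; lia.
case/orP: bx => [/eqP -> |bx]; case/orP: byy => [/eqP -> //|byy].
- exact: before_trans ji byy.
- exact: before_trans bx ji.
- exact: before_trans bx (before_trans ji byy).
Qed.

(** * Congruences are determined by their arcs *)

Lemma is_meet_le s t : weak_le s t -> is_meet s t s.
Proof. by split=> //; exact: weak_le_refl. Qed.

Lemma is_meetC s t m : is_meet s t m -> is_meet t s m.
Proof. by case=> ms mt mm; split=> // u us ut; apply: mm. Qed.

Lemma is_joinC s t m : is_join s t m -> is_join t s m.
Proof. by case=> ms mt mm; split=> // u us ut; apply: mm. Qed.

Lemma is_join_le s t : weak_le s t -> is_join s t t.
Proof. by split=> //; exact: weak_le_refl. Qed.

Section Equivalence.
Variable e : rel 'S_n.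
Hypothesis e_eqv : equivalence_rel e.

Lemma eqv_refl s : e s s.
Proof. by case: (e_eqv s s s). Qed.

Lemma eqv_sym s t : e s t -> e t s.
Proof. by move=> st; case: (e_eqv s t s) => _ /(_ st) <-; exact: eqv_refl. Qed.

Lemma eqv_trans s t u : e s t -> e t u -> e s u.
Proof. by move=> st; case: (e_eqv s t u) => _ /(_ st) ->. Qed.

(** The classes of an equivalence compatible with meets are convex, so that two
equivalent permutations are joined, through their meet, by a path of steps
that stays in their class. *)
Lemma meet_congruence_ind (P : 'S_n -> Prop) s t :
  (forall s s' t t' m m', e s s' -> e t t' -> is_meet s t m -> is_meet s' t' m' -> e m m') ->
  (forall a u v, arc_step a u v -> e u v -> (P u <-> P v)) ->
  e s t -> P s -> P t.
Proof.
move=> meetP stepP st.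
have [m mm] := meet_exists s t; have [ms mt _] := mm.
have sm : e s m.
  by apply: (meetP s s s t) mm => //; [exact: eqv_refl|apply: is_meet_le; exact: weak_le_refl].
have tm : e t m by apply: eqv_trans (eqv_sym st) sm.
have conv u v w : e v w -> weak_le v w -> in_hull v w u -> e u v.
  move=> vw le h; have [vu uw] := hull_interval le h.
  apply: (meetP w v u u) (eqv_sym vw) (eqv_refl u) _ _.
    by apply: is_meetC; apply: is_meet_le.
  exact: is_meet_le.
have go v w : e v w -> weak_le v w -> (P v <-> P w).
  move=> vw le.
  have st1 u1 u2 a : in_hull v w u1 -> in_hull v w u2 ->
      arc_step a u1 u2 \/ arc_step a u2 u1 -> (P u1 <-> P u2).
    move=> /(conv _ _ _ vw le) h1 /(conv _ _ _ vw le) h2.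
    have h12 := eqv_trans h1 (eqv_sym h2).
    case=> /stepP; [exact|move=> /(_ (eqv_sym h12)) ->//].
  split; first by apply: hull_ind => u1 u2 a h1 h2 /(st1 _ _ _ h1 h2) ->.
  apply: hull_ind => u1 u2 a h1 h2 st2 P1; apply/(st1 u1 u2 a) => //.
  - by move=> p q b1 b2; apply: h1.
  - by move=> p q b1 b2; apply: h2.
by move/(go _ _ (eqv_sym sm) ms)/(go _ _ (eqv_sym tm) mt).
Qed.

End Equivalence.

(** A step [s -> t] labelled [a] is perspective to the step below [arc_perm a],
so both are contracted simultaneously. *)
Lemma step_congruence e a s t : lattice_congruence e -> arc_step a s t ->
  e s t = (a \notin arcs_of e).
Proof.
case=> eqv meetP joinP st.
have [s0 st0] := arc_perm_step a.
have le0 := step_le st0; have le := step_le st; have at_le := step_arc_perm_le st.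
have notji u : weak_le u s -> before u (arc_tgt a) (arc_src a) = false.
  move=> /weak_leP us; apply/negP => /(us _ _ (arc_lt a)).
  by case: (st) => /before_asym ->.
have low u : weak_le u (arc_perm a) -> ~~ before u (arc_tgt a) (arc_src a) -> weak_le u s0.
  move=> /weak_leP us nji; apply/weak_leP => x y yx b.
  move: (us x y yx b); rewrite (step_inv st0 yx) => /orP[/eqP [ex ey]|//].
  by rewrite ex ey in b; rewrite b in nji.
have meet0 : is_meet (arc_perm a) s s0.
  split=> // [|u ua us].
    apply/weak_leP => x y yx b.
    have := weak_leP _ _ (weak_le_trans le0 at_le) x y yx b.
    rewrite (step_inv st yx) => /orP[/eqP [ex ey]|//].
    by case: st0; rewrite -ex -ey => /before_asym; rewrite b.
  by apply: (low _ ua); rewrite notji.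
have [_ s0s _] := meet0.
have join0 : is_join (arc_perm a) s t.
  split=> // u /weak_leP au /weak_leP su; apply/weak_leP => x y yx.
  rewrite (step_inv st yx) => /orP[/eqP [-> ->]|]; last exact: su.
  by apply: au; [exact: arc_lt|exact: arc_perm_src_tgt].
apply/idP/idP => [est|].
  have e0 : e s0 (arc_perm a).
    by apply: (meetP _ _ _ _ _ _ (eqv_refl eqv (arc_perm a)) est meet0); apply: is_meet_le.
  rewrite inE; apply/forallPn; exists s0; rewrite (eqv_sym eqv e0) /=; exact: step_nle st0.
rewrite inE => /forallPn [t']; rewrite negb_imply => /andP[et' nle].
have [m mm] := meet_exists (arc_perm a) t'; have [ma mt' _] := mm.
have em : e (arc_perm a) m.
  apply: (meetP _ _ _ _ _ _ (eqv_refl eqv (arc_perm a)) et' _ mm).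
  by apply: is_meet_le; exact: weak_le_refl.
have ms0 : weak_le m s0.
  apply: (low _ ma); apply: contra nle => /(below_arc_perm ma) am; exact: weak_le_trans am mt'.
have e0 : e s0 (arc_perm a).
  apply: (eqv_sym eqv); apply: (joinP _ _ _ _ _ _ em (eqv_refl eqv s0)).
    by apply: is_joinC; apply: is_join_le.
  exact: is_join_le.
exact: (joinP _ _ _ _ _ _ e0 (eqv_refl eqv s) (is_join_le s0s) join0).
Qed.

Lemma congruence_ind e (P : 'S_n -> Prop) s t : lattice_congruence e ->
  (forall a u v, arc_step a u v -> a \notin arcs_of e -> (P u <-> P v)) ->
  e s t -> P s -> P t.
Proof.
move=> ce stepP; have [eqv meetP _] := ce; apply: meet_congruence_ind => // a u v st.
by rewrite (step_congruence ce st); exact: stepP st.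
Qed.

Lemma congruence_determined e e' : lattice_congruence e -> lattice_congruence e' ->
  arcs_of e = arcs_of e' -> e =2 e'.
Proof.
have imp e1 e2 s t : lattice_congruence e1 -> lattice_congruence e2 ->
    arcs_of e1 = arcs_of e2 -> e1 s t -> e2 s t.
  move=> c1 c2 eqA st; have [eqv _ _] := c2.
  apply: (congruence_ind (P := e2 s) c1 _ st); last exact: eqv_refl.
  move=> a u v auv; rewrite eqA -(step_congruence c2 auv) => uv.
  by split=> h; apply: (eqv_trans eqv h); [|apply: eqv_sym].
by move=> c c' eqA s t; apply/idP/idP; apply: imp.
Qed.

(** * The congruence of an arc ideal *)

Definition arc_ideal I : Prop := forall a b, subarc a b -> b \in I -> a \in I.

(** This relation is compatible with meets by construction.  It is also compatible
with joins because it is carried by the reversal of permutations to the relation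
of the same form for the flipped arcs, see [congr_of_rev]. *)
Definition congr_of I : rel 'S_n := fun s t =>
  [forall a in I, weak_le (arc_perm a) s == weak_le (arc_perm a) t].

Lemma congr_ofP I s t :
  reflect (forall a, a \in I -> weak_le (arc_perm a) s = weak_le (arc_perm a) t) (congr_of I s t).
Proof.
by apply: (iffP forallP) => [H a aI|H a]; [have /implyP/(_ aI)/eqP := H a|apply/implyP=> /H ->].
Qed.

(** A step labelled [a] acquires the inversion of the ends of [a]; if [arc_perm b]
is below the top of the step and has this inversion, then [a] is a subarc of
[b]. *)
Lemma step_congr_of I a s t : arc_ideal I -> arc_step a s t -> congr_of I s t = (a \notin I).
Proof.
move=> idI st; apply/congr_ofP/idP => [eqI|nI b bI].
  apply/negP => /eqI; rewrite (step_arc_perm_le st) => /weak_leP /(_ _ _ (arc_lt a)).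
  by rewrite arc_perm_src_tgt; case: (st) => /before_asym -> _ _ /(_ isT).
apply/idP/idP => [bs|/weak_leP bt]; first exact: weak_le_trans bs (step_le st).
apply/weak_leP => x y yx bxy; move: (bt x y yx bxy).
rewrite (step_inv st yx) => /orP[/eqP [ex ey]|//].
case/negP: nI; apply: idI bI; have [_ tE sA] := st.
rewrite ex ey arc_perm_inv ?arc_lt // in bxy; case/andP: bxy => jP iP.
have lt := arc_lt b.
have lts : arc_src b <= arc_src a.
  by case/orP: iP => [/eqP ->//|/in_arc_B_between]; lia.
have ltt : arc_tgt a <= arc_tgt b.
  by case/orP: jP => [/eqP ->//|/in_arc_A_between]; lia.
apply/subarcP; split=> // c ct; rewrite sA //; apply/idP/idP => [cj|cA].
  apply: contraLR cj => ncA; rewrite -in_arc_B in ncA; last by lia.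
  have : before t (arc_tgt a) c by apply: bt; [lia|rewrite arc_perm_inv ?jP ?ncA ?orbT //; lia].
  rewrite (step_inv st); last by lia.
  rewrite xpair_eqE -!val_eqE /= => /orP[|/before_asym -> //]; lia.
rewrite -(step_src st) -?val_eqE /=; try lia.
have : before t c (arc_src a) by apply: bt; [lia|rewrite arc_perm_inv ?iP ?cA ?orbT //; lia].
rewrite (step_inv st); last by lia.
by rewrite xpair_eqE -!val_eqE /= => /orP[|//]; lia.
Qed.

Lemma congr_of_equivalence I : equivalence_rel (congr_of I).
Proof.
move=> s t u; split; first by apply/congr_ofP.
move=> /congr_ofP st; apply/idP/idP => /congr_ofP h; apply/congr_ofP => a aI.
  by rewrite -st // h.
by rewrite st // h.
Qed.

Lemma congr_of_meet I s s' t t' m m' : congr_of I s s' -> congr_of I t t' ->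
  is_meet s t m -> is_meet s' t' m' -> congr_of I m m'.
Proof.
move=> /congr_ofP ss /congr_ofP tt.
have leM u v w r : is_meet u v w -> weak_le r w = weak_le r u && weak_le r v.
  case=> wu wv mw; apply/idP/andP => [rw|[]]; last exact: mw.
  by split; apply: weak_le_trans rw _.
by move=> mm mm'; apply/congr_ofP => a aI; rewrite (leM _ _ _ _ mm) (leM _ _ _ _ mm') ss ?tt.
Qed.

(** * Reversal of permutations and of arcs *)

Lemma is_arc_flip a : is_arc (arc_src a, arc_tgt a, arc_B a, arc_A a).
Proof.
case/and3P: (arc_quadE a) => lt AB dis; apply/and3P; split=> //; first by rewrite setUC.
by rewrite disjoint_sym.
Qed.

Definition flip_arc a : arc n := Arc (is_arc_flip a).

Lemma flip_arcK : involutive flip_arc.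
Proof. by move=> a; apply: arc_ext. Qed.

Lemma subarc_flip a b : subarc (flip_arc a) (flip_arc b) = subarc a b.
Proof. by rewrite /subarc /= [X in _ && (_ && X)]andbC. Qed.

Lemma step_rev a s t : arc_step a s t -> arc_step (flip_arc a) (rev_perm t) (rev_perm s).
Proof.
move=> st; have [ij tE sA] := st; have lt := arc_lt a.
split=> [|x y|c ct]; rewrite ?before_rev.
- exact: step_before st.
- have swp (p q r w : 'I_n) : ((p, q) == (r, w)) = ((q, p) == (w, r)).
    by rewrite !xpair_eqE andbC.
  rewrite tE (swp x y (arc_tgt _)) (swp x y (arc_src _)) /arc_src /arc_tgt /=.
  rewrite -/(arc_src a) -/(arc_tgt a).
  case: (eqVneq (y, x) (arc_src a, arc_tgt a)) => [[-> ->]|neq] /=; first by rewrite ij.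
  case: (eqVneq (y, x) (arc_tgt a, arc_src a)) => [[-> ->]|_] /=; last by rewrite !andbT.
  by rewrite (before_asym ij).
- have cc : arc_src a < c < arc_tgt a := ct.
  rewrite -[LHS]/(c \in arc_B a) -[arc_tgt _]/(arc_tgt a) in_arc_B // sA //.
  rewrite -before_neg -?val_eqE /= ?gtn_eqF //; last by case/andP: cc.
  rewrite tE !xpair_eqE -!val_eqE /=; lia.
Qed.

End Congruences.

Section ArcIdeals.
Variable n : nat.
Implicit Types (s t u v m : 'S_n) (x y z c p q : 'I_n) (a b : arc n) (e : rel 'S_n).
Implicit Types (I G : {set arc n}).

Definition flip_arcs I : {set arc n} := [set a | flip_arc a \in I].

Lemma flip_arcsK : involutive flip_arcs.
Proof. by move=> I; apply/setP=> a; rewrite !inE flip_arcK. Qed.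

Lemma arc_ideal_flip I : arc_ideal I -> arc_ideal (flip_arcs I).
Proof. by move=> idI a b; rewrite !inE -subarc_flip; apply: idI. Qed.

(** Equivalent permutations are joined by contracted steps, and the reversal of a
step labelled [a] is a step labelled [flip_arc a]. *)
Lemma congr_of_rev I s t : arc_ideal I -> congr_of I s t ->
  congr_of (flip_arcs I) (rev_perm s) (rev_perm t).
Proof.
move=> idI st; have eqv := @congr_of_equivalence n (flip_arcs I).
apply: (meet_congruence_ind (P := fun t => congr_of (flip_arcs I) (rev_perm s) (rev_perm t))
  (@congr_of_equivalence n I) _ _ st); last exact: eqv_refl.
  exact: congr_of_meet.
move=> a u v auv; rewrite (step_congr_of idI auv) => nI.
have uv : congr_of (flip_arcs I) (rev_perm v) (rev_perm u).
  by rewrite (step_congr_of (arc_ideal_flip idI) (step_rev auv)) inE flip_arcK.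
by split=> h; apply: (eqv_trans eqv h); [apply: eqv_sym|].
Qed.

Lemma congr_of_lattice_congruence I : arc_ideal I -> lattice_congruence (congr_of I).
Proof.
move=> idI; split; [exact: congr_of_equivalence|exact: congr_of_meet|].
move=> s s' t t' m m' /(congr_of_rev idI) ss /(congr_of_rev idI) tt.
move=> /is_meet_rev mm /is_meet_rev mm'.
have := congr_of_rev (arc_ideal_flip idI) (congr_of_meet ss tt mm mm').
by rewrite flip_arcsK !rev_permK.
Qed.

Lemma arcs_of_congr_of I : arc_ideal I -> arcs_of (congr_of I) = I.
Proof.
move=> idI; apply/setP=> a; have [s st] := arc_perm_step a.
apply: negb_inj; rewrite -(step_congruence (congr_of_lattice_congruence idI) st).
exact: step_congr_of.
Qed.

(** * Congruences with prescribed contracted arcs *)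

Lemma arc_ideal_setC_upper G : arc_ideal (~: upper_ideal G).
Proof.
move=> a b ab; rewrite !inE; apply: contra => /existsP[g /andP[gG ga]].
by apply/existsP; exists g; rewrite gG (subarc_trans ga ab).
Qed.

Lemma congr_of_contracting G :
  the_congruence_contracting G (congr_of (~: upper_ideal G)).
Proof.
have idG := @arc_ideal_setC_upper G.
have cG := congr_of_lattice_congruence idG.
split=> //; first by rewrite arcs_of_congr_of // setCK.
move=> e ce eG; apply: congruence_determined => //.
by rewrite arcs_of_congr_of // -eG setCK.
Qed.

Lemma rev_lattice_congruence e : lattice_congruence e ->
  lattice_congruence (fun s t => e (rev_perm s) (rev_perm t)).
Proof.
case=> eqv meetP joinP; split=> [s t u|s s' t t' m m' ss tt|s s' t t' m m' ss tt].
- exact: eqv.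
- by move=> /is_join_rev mm /is_join_rev; apply: joinP mm.
- by move=> /is_meet_rev mm /is_meet_rev; apply: meetP mm.
Qed.

Lemma arcs_of_rev e a : lattice_congruence e ->
  (a \in arcs_of (fun s t => e (rev_perm s) (rev_perm t))) = (flip_arc a \in arcs_of e).
Proof.
move=> ce; have [s st] := arc_perm_step a; apply: negb_inj.
rewrite -(step_congruence (rev_lattice_congruence ce) st) -(step_congruence ce (step_rev st)).
by case: ce => eqv _ _; apply/idP/idP; apply: eqv_sym.
Qed.

(** * Forcing: the arcs of a congruence form an ideal *)

(** The inversion of the ends of [b], composed with inversions that the permutation
below [arc_perm a] has, yields the inversion of the ends of [a]. *)
Lemma forcing_above a b sa r : arc_step a sa (arc_perm a) ->
  (arc_src b == arc_src a) || (arc_src b \in arc_A a) ->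
  (arc_tgt b == arc_tgt a) || (arc_tgt b \in arc_B a) ->
  weak_le sa r -> weak_le (arc_perm b) r -> weak_le (arc_perm a) r.
Proof.
move=> sta bi bj /weak_leP say /weak_leP by_.
have lt := arc_lt a.
have i'i : (arc_src b == arc_src a) || before r (arc_src b) (arc_src a).
  case/orP: bi => [->//|iA]; apply/orP; right.
  have /andP[ib bj'] := in_arc_A_between iA; apply: say => //.
  have : before (arc_perm a) (arc_src b) (arc_src a) by rewrite arc_perm_inv // iA eqxx orbT.
  by rewrite (step_inv sta ib) xpair_eqE -val_eqE /= (ltn_eqF bj').
have jj' : (arc_tgt b == arc_tgt a) || before r (arc_tgt a) (arc_tgt b).
  case/orP: bj => [->//|jB]; apply/orP; right.
  have /andP[ib bj'] := in_arc_B_between jB; apply: say => //.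
  have : before (arc_perm a) (arc_tgt a) (arc_tgt b) by rewrite arc_perm_inv // jB eqxx orbT.
  by rewrite (step_inv sta bj') xpair_eqE -!val_eqE /= (gtn_eqF ib) andbF.
have j'i' := by_ _ _ (arc_lt b) (arc_perm_src_tgt b).
have ji : before r (arc_tgt a) (arc_src a).
  case/orP: i'i => [/eqP <-|i'i]; case/orP: jj' => [/eqP <-|jj'] //.
  - exact: before_trans jj' j'i'.
  - exact: before_trans j'i' i'i.
  - exact: before_trans jj' (before_trans j'i' i'i).
apply/weak_leP => x z zx; rewrite (step_inv sta zx) => /orP[/eqP [-> -> //]|].
exact: say.
Qed.

(** Such a bound [w] lists the other points of [arc_A a], then the sources of [b]
and [a], then their targets, then the remaining points: apart from those of the
ends of [a] and of [b], the inversions of [arc_perm a] and [arc_perm b] agree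
with this list. *)
Lemma forcing_bound a b : subarc b a ->
  (arc_src b == arc_src a) || (arc_src b \in arc_A a) ->
  (arc_tgt b == arc_tgt a) || (arc_tgt b \in arc_B a) ->
  exists w, [/\ before w (arc_src a) (arc_tgt a),
    forall s, arc_step a s (arc_perm a) -> weak_le s w &
    forall s, arc_step b s (arc_perm b) -> weak_le s w].
Proof.
case/subarcP=> ssrc stgt sA bi bj.
have lta := arc_lt a; have ltb := arc_lt b.
pose rk z : nat := if z == arc_src b then n else if z == arc_src a then n.+1
  else if z == arc_tgt a then n.+2 else if z == arc_tgt b then n.+3
  else if z \in arc_A a then nat_of_ord z else n + 4 + z.
have rk_inj : injective rk.
  move=> x y; rewrite /rk; have := ltn_ord x; have := ltn_ord y.
  case: (eqVneq x (arc_src b)) => [->|_]; case: (eqVneq y (arc_src b)) => [->|_] //;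
    try (repeat (case: ifP => _); lia).
  case: (eqVneq x (arc_src a)) => [->|_]; case: (eqVneq y (arc_src a)) => [->|_] //;
    try (repeat (case: ifP => _); lia).
  case: (eqVneq x (arc_tgt a)) => [->|_]; case: (eqVneq y (arc_tgt a)) => [->|_] //;
    try (repeat (case: ifP => _); lia).
  case: (eqVneq x (arc_tgt b)) => [->|_]; case: (eqVneq y (arc_tgt b)) => [->|_] //;
    try (repeat (case: ifP => _); lia).
  by case: ifP => _; case: ifP => _ ? ? eqr; apply: val_inj => /=; lia.
have [w wE] := perm_of_rank rk_inj.
have rk_src_b : rk (arc_src b) = n by rewrite /rk eqxx.
have rk_src_a : rk (arc_src a) <= n.+1 by rewrite /rk eqxx; case: ifP.
have rk_tgt_a : rk (arc_tgt a) = n.+2.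
  by rewrite /rk eqxx -!val_eqE /= !gtn_eqF //; apply: leq_trans ltb stgt.
have rk_tgt_b : n.+2 <= rk (arc_tgt b) <= n.+3.
  rewrite /rk eqxx -!val_eqE /= (gtn_eqF ltb) (gtn_eqF (leq_ltn_trans ssrc ltb)).
  by case: ifP; rewrite !leqnn ?leqnSn.
have rkA x : x \in arc_A a -> rk x < n \/ x = arc_src b.
  move=> xA; have /andP[ix xj] := in_arc_A_between xA; rewrite /rk xA.
  case: eqP => [->|_]; [by right|left]; rewrite -!val_eqE /= (gtn_eqF ix) (ltn_eqF xj).
  case: eqP => [xb|_]; last exact: ltn_ord.
  by case/orP: bj => [|]; [by rewrite -val_eqE /=; lia|rewrite -(val_inj xb) (arc_AB xA)].
have rkB y : arc_src a < y < arc_tgt a -> y \notin arc_A a ->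
    n + 3 + (y != arc_tgt b) <= rk y.
  case/andP=> iy yj nA; rewrite /rk (negPf nA).
  have [-> ->] : (y == arc_src a) = false /\ (y == arc_tgt a) = false.
    by rewrite -!val_eqE /= (gtn_eqF iy) (ltn_eqF yj).
  case: (eqVneq y (arc_src b)) => [yb|_]; last by case: eqVneq; lia.
  by case/orP: bi; rewrite -yb ?(negPf nA) // -val_eqE /=; lia.
exists w; split=> [|s st|s st].
- by rewrite wE rk_tgt_a.
- apply/weak_leP => x y yx sxy; rewrite wE; have [bij _ _] := st.
  have := weak_leP _ _ (step_le st) x y yx sxy; rewrite arc_perm_inv //.
  case/andP=> /orP[/eqP ex|xA] /orP[/eqP ey|yB].
  + by rewrite ex ey (before_asym bij) in sxy.
  + rewrite ex rk_tgt_a -addn3; apply: leq_trans (rkB y _ _); rewrite -?addnA ?leq_add2l //.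
      exact: in_arc_B_between.
    by apply: contraL yB => /arc_AB ->.
  + rewrite ey; case: (rkA x xA) => [lt|ex].
      have : n <= rk (arc_src a) by rewrite /rk eqxx; case: ifP.
      exact: leq_trans.
    rewrite ex rk_src_b /rk eqxx -ex -val_eqE /= ltn_eqF //; by rewrite -ey.
  + have lt : rk x <= n by case: (rkA x xA) => [/ltnW //|->]; rewrite rk_src_b.
    apply: leq_ltn_trans lt (leq_trans _ (rkB y (in_arc_B_between yB) _)); first by lia.
    by apply: contraL yB => /arc_AB ->.
- apply/weak_leP => x y yx sxy; rewrite wE; have [bij _ _] := st.
  have := weak_leP _ _ (step_le st) x y yx sxy; rewrite arc_perm_inv //.
  have yB3 : y \in arc_B b -> n + 4 <= rk y.
    move=> yB; have yb := in_arc_B_between yB; apply: leq_trans (rkB y _ _); last 2 first.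
    - by lia.
    - by rewrite -sA // -in_arc_B.
    - by rewrite -val_eqE /=; lia.
  have xA1 : x \in arc_A b -> rk x < n.
    move=> xA; have xb := in_arc_A_between xA; case: (rkA x) => //; first by rewrite -sA.
    by move=> ex; rewrite ex ltnn in xb.
  case/andP=> /orP[/eqP ex|xA] /orP[/eqP ey|yB].
  + by rewrite ex ey (before_asym bij) in sxy.
  + by rewrite ex; have := yB3 yB; lia.
  + by rewrite ey rk_src_b xA1.
  + by apply: ltn_trans (xA1 xA) _; have := yB3 yB; lia.
Qed.

(** Let [sa] and [sb] be the permutations below [arc_perm a] and [arc_perm b].
If [b] is contracted, the joins of [sa] with [sb] and with [arc_perm b] are
equivalent, but only the second one is above [arc_perm a], so that [a] is
contracted. *)
Lemma forcing_join e a b : lattice_congruence e -> subarc b a ->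
  (arc_src b == arc_src a) || (arc_src b \in arc_A a) ->
  (arc_tgt b == arc_tgt a) || (arc_tgt b \in arc_B a) ->
  a \in arcs_of e -> b \in arcs_of e.
Proof.
move=> ce ba bi bj aA; apply: contraT => nb.
have [eqv meetP joinP] := ce.
have [sa sta] := arc_perm_step a; have [sb stb] := arc_perm_step b.
have esb : e sb (arc_perm b) by rewrite (step_congruence ce stb).
have [y1 j1] := join_exists sb sa; have [_ _ min1] := j1.
have [y2 j2] := join_exists (arc_perm b) sa; have [b2 sa2 _] := j2.
have e12 : e y1 y2 by apply: (joinP _ _ _ _ _ _ esb (eqv_refl eqv sa)) j1 j2.
have ay2 := forcing_above sta bi bj sa2 b2.
have [m mm] := meet_exists y1 (arc_perm a); have [my1 _ _] := mm.
have em : e (arc_perm a) m.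
  apply: (eqv_sym eqv); apply: (meetP _ _ _ _ _ _ e12 (eqv_refl eqv (arc_perm a)) mm).
  by apply: is_meetC; apply: is_meet_le.
move: aA; rewrite inE => /forallP /(_ m); rewrite em /= => am.
have [w [bij saw sbw]] := forcing_bound ba bi bj.
have y1w := min1 w (sbw _ stb) (saw _ sta).
have := weak_leP _ _ (weak_le_trans am (weak_le_trans my1 y1w)) _ _ (arc_lt a).
by rewrite arc_perm_src_tgt (before_asym bij) => /(_ isT).
Qed.

(** Move the source of [a] to that of [b], then its target: each of these moves
is an instance of [forcing_join], possibly after reversal. *)
Lemma forcing e a b : lattice_congruence e -> subarc b a ->
  a \in arcs_of e -> b \in arcs_of e.
Proof.
have flipped e' a' b' : lattice_congruence e' -> subarc b' a' ->
  (arc_src b' == arc_src a') || (arc_src b' \in arc_B a') ->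
  (arc_tgt b' == arc_tgt a') || (arc_tgt b' \in arc_A a') ->
  a' \in arcs_of e' -> b' \in arcs_of e'.
  move=> ce ba bi bj.
  have := @forcing_join _ (flip_arc a') (flip_arc b') (rev_lattice_congruence ce).
  by rewrite !(arcs_of_rev _ ce) !flip_arcK subarc_flip; apply.
move=> ce ba; have [si tj sA] := subarcP _ _ ba; have lt := arc_lt b.
have lt' : arc_src b < arc_tgt a by lia.
pose d := cut_arc lt' (fun c => c \in arc_A a).
have da : subarc d a.
  by apply/subarcP; split=> // c ct; rewrite in_cut_arc ct.
have bd : subarc b d.
  apply/subarcP; split=> // c ct; rewrite in_cut_arc sA //.
  by rewrite (_ : _ < _ < _); lia.
move=> aA; have : d \in arcs_of e.
  case: (boolP (arc_src d == arc_src a)) => [eqs|ne].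
    by apply: (forcing_join ce da) aA; rewrite ?eqs ?eqxx.
  have : arc_src a < arc_src d < arc_tgt a.
    by rewrite -val_eqE /= /arc_src /= -/(arc_src a) in ne *; lia.
  rewrite in_arc_between => /orP[sd|sd].
    by apply: (forcing_join ce da) aA; rewrite ?sd ?orbT ?eqxx.
  by apply: (flipped _ _ _ ce da) aA; rewrite ?sd ?orbT ?eqxx.
case: (boolP (arc_tgt b == arc_tgt d)) => [eqs|ne].
  by apply: (forcing_join ce bd); rewrite ?eqs ?eqxx.
have : arc_src d < arc_tgt b < arc_tgt d.
  rewrite -val_eqE /= /arc_src /arc_tgt /= in ne *.
  by rewrite -/(arc_tgt a) -/(arc_tgt b) -/(arc_src b) in ne *; lia.
rewrite in_arc_between => /orP[sd|sd].
  by apply: (flipped _ _ _ ce bd); rewrite ?sd ?orbT ?eqxx.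
by apply: (forcing_join ce bd); rewrite ?sd ?orbT ?eqxx.
Qed.

End ArcIdeals.

(** * Trees *)

Section Trees.
Variable n : nat.
Implicit Types (T : rel 'I_n) (x y z v w p q i j k c : 'I_n) (a b : arc n).

(** Reversing the edges exchanges parents and children, hence ancestor and
descendant subtrees, up and down arcs: half of the statements follow from the
other half. *)
Definition opp T : rel 'I_n := fun x y => T y x.

Definition avoiding T v : rel 'I_n := fun x y => [&& x != v, y != v & undirected T x y].

Lemma in_component T v p x : (x \in component T v p) = connect (avoiding T v) p x.
Proof. by rewrite inE. Qed.

Lemma connect_opp T x y : connect (opp T) x y = connect T y x.
Proof. exact: connect_rev. Qed.

Lemma undirected_opp T : undirected (opp T) =2 undirected T.
Proof. by move=> x y; rewrite /undirected orbC. Qed.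

Lemma avoiding_opp T v : avoiding (opp T) v =2 avoiding T v.
Proof. by move=> x y; rewrite /avoiding undirected_opp. Qed.

Lemma component_opp T v p : component (opp T) v p = component T v p.
Proof. by apply/setP=> x; rewrite !in_component (eq_connect (avoiding_opp T v)). Qed.

Lemma parents_opp T v : parents (opp T) v = children T v.
Proof. by apply/setP=> x; rewrite !inE. Qed.

Lemma children_opp T v : children (opp T) v = parents T v.
Proof. by apply/setP=> x; rewrite !inE. Qed.

Lemma directed_tree_opp T : directed_tree T -> directed_tree (opp T).
Proof.
case=> asym conn acyc; split=> [x y|x y|c c2]; first exact: asym.
  by rewrite (eq_connect (undirected_opp T)).
by move: (acyc c c2); rewrite /ucycleb (eq_cycle (undirected_opp T)).
Qed.

Lemma separating_tree_opp T : separating_tree T -> separating_tree (opp T).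
Proof.
case=> tree card par chi; split=> [|j|j p q|j p q].
- exact: directed_tree_opp.
- by rewrite (parents_opp T) (children_opp T); have [] := card j.
- by rewrite (parents_opp T) !(component_opp T); apply: chi.
- by rewrite (children_opp T) !(component_opp T); apply: par.
Qed.

Lemma undirected_sym T : symmetric (undirected T).
Proof. by move=> x y; rewrite /undirected orbC. Qed.

Lemma avoiding_sym T v : symmetric (avoiding T v).
Proof. by move=> x y; rewrite /avoiding undirected_sym andbCA. Qed.

Lemma avoiding_connect_sym T v : connect_sym (avoiding T v).
Proof. exact/sym_connect_sym/avoiding_sym. Qed.

Lemma connect_ind (e : rel 'I_n) (P : 'I_n -> Prop) x y :
  (forall u v, connect e x u -> e u v -> P u -> P v) -> P x -> connect e x y -> P y.
Proof.
move=> step Px /connectP [p]; elim/last_ind: p y => [|p z IH] y; first by move=> _ ->.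
rewrite rcons_path last_rcons => /andP[pth ez] ->.
by apply: step ez (IH _ pth erefl); apply/connectP; exists p.
Qed.

Lemma connect_last (e : rel 'I_n) x y : connect e x y -> x != y ->
  exists2 z, connect e x z & e z y.
Proof.
case/connectP=> p; elim/last_ind: p y => [|p z IH] y; first by move=> _ ->; rewrite eqxx.
rewrite rcons_path last_rcons => /andP[pth ez] -> _.
by exists (last x p) => //; apply/connectP; exists p.
Qed.

Lemma connect_first (e : rel 'I_n) x y : connect e x y -> x != y ->
  exists2 z, e x z & connect e z y.
Proof.
case/connectP=> [[|z p] /=]; first by move=> _ ->; rewrite eqxx.
by case/andP=> xz pth yl _; exists z => //; apply/connectP; exists p.
Qed.

Lemma sub_connect_ind (e e' : rel 'I_n) x y : connect e x y ->
  (forall u v, connect e x u -> e u v -> connect e' x u -> e' u v) -> connect e' x y.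
Proof.
move=> xy step; apply: (connect_ind (P := connect e' x)) xy; last exact: connect0.
by move=> u v xu uv xu'; apply: (connect_trans xu' (connect1 (step _ _ xu uv xu'))).
Qed.

Section DirectedTree.
Variable T : rel 'I_n.
Hypothesis treeT : directed_tree T.

Lemma tree_irr x : T x x = false.
Proof. by case: treeT => asym _ _; apply/negP => xx; move: (asym x x xx); rewrite xx. Qed.

Lemma tree_neq x y : T x y -> x != y.
Proof. by apply: contraTneq => ->; rewrite tree_irr. Qed.

Lemma tree_undirected_neq x y : undirected T x y -> x != y.
Proof. by case/orP => /tree_neq //; rewrite eq_sym. Qed.

(** Otherwise [v] would lie on a cycle through [p] and [q]. *)
Lemma neighbors_separated v p q : undirected T v p -> undirected T v q ->
  connect (avoiding T v) p q -> p = q.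
Proof.
move=> vp vq /connectP [r pth ql]; apply/eqP; apply: contraT => pq.
case/shortenP: pth ql => r' pth ur' _ ql.
case: treeT => _ _ /(_ [:: v, p & r']) acyc.
have nv : v \notin p :: r'.
  have : all [pred x | x != v] (p :: r').
    rewrite /= eq_sym (tree_undirected_neq vp) /=.
    elim: r' p {vp pq ur' ql acyc} pth => //= y r' IH p /andP[/and3P[_ -> _]] /IH.
    by [].
  by apply: contraL => vr; apply/allPn; exists v; rewrite //= eqxx.
have sz : 2 < size [:: v, p & r'].
  by case: r' ql {pth ur' nv acyc} => //= eqq; rewrite eqq eqxx in pq.
case/negP: (acyc sz); rewrite /ucycleb cons_uniq nv ur' andbT /= vp rcons_path -ql.
rewrite undirected_sym vq !andbT /=.
by move: pth; apply: sub_path => x y /and3P[].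
Qed.

(** A closed directed walk would contain a cycle. *)
Lemma tree_acyclic x y : T x y -> connect T y x = false.
Proof.
move=> xy; apply/negP => /connectP [p pth xl].
case/shortenP: pth xl => p' pth up _ xl.
have [asym _ acyc] := treeT.
case: p' => [|z [|z' p']] in pth up xl.
- by rewrite xl /= tree_irr in xy.
- by case/andP: pth => yz _; rewrite xl /= in xy; case/negP: (asym _ _ xy).
case/negP: (acyc (y :: z :: z' :: p') isT); rewrite /ucycleb up andbT.
rewrite -[path.cycle _ _]/(path _ y (rcons (z :: z' :: p') y)) rcons_path -xl.
have -> : undirected T x y by rewrite /undirected xy.
by rewrite andbT; move: pth; apply: sub_path => u v; rewrite /undirected => ->.
Qed.

Lemma tree_anti x y : connect T x y -> connect T y x -> x = y.
Proof.
move=> xy yx; apply/eqP; apply: contraT => /(connect_first xy) [z xz zy].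
by have := tree_acyclic xz; rewrite (connect_trans zy yx).
Qed.

Lemma connect_component v p x : connect T p x -> ~~ connect T p v -> x \in component T v p.
Proof.
move=> px npv; rewrite in_component; apply: (sub_connect_ind px) => u w pu uw _.
have pw := connect_trans pu (connect1 uw); rewrite /avoiding /undirected uw andbT.
by apply/andP; split; [move: pu|move: pw]; apply: contraTneq => ->.
Qed.

Lemma connect_component_rev v p x : connect T x p -> ~~ connect T v p -> x \in component T v p.
Proof.
rewrite -!(connect_opp T) => px npv; rewrite in_component.
apply: (sub_connect_ind px) => u w pu uw _.
have pw := connect_trans pu (connect1 uw); rewrite /avoiding /undirected orbC.
rewrite [T w u]uw andbT.
by apply/andP; split; [move: pu|move: pw]; apply: contraTneq => ->.
Qed.

(** A second directed path from [x] to [y] would connect two neighbors of [x]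
outside [x]. *)
Lemma tree_cover x y z : T x y -> connect T x z -> connect T z y -> z = x \/ z = y.
Proof.
move=> xy xz zy; case: (eqVneq z x) => [->|zx]; first by left.
rewrite eq_sym in zx; have [p xp pz] := connect_first xz zx; right.
have py : p = y; last by subst p; apply: tree_anti.
apply: (neighbors_separated (v := x)); rewrite /undirected ?xp ?xy //.
rewrite -in_component; apply: connect_component; first exact: connect_trans pz zy.
by rewrite (tree_acyclic xp).
Qed.

Lemma mem_component v p : p \in component T v p.
Proof. by rewrite in_component connect0. Qed.

Lemma component_neq v p x : p != v -> x \in component T v p -> x != v.
Proof.
rewrite in_component => pv px; case: (eqVneq p x) => [<- //|neq].
by have [z _ /and3P[_ ->]] := connect_last px neq.
Qed.

Lemma component_closed v p x y : p != v -> x \in component T v p -> undirected T x y -> y != v ->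
  y \in component T v p.
Proof.
move=> pv xp xy yv; have xv := component_neq pv xp; rewrite !in_component in xp *.
by apply: connect_trans xp (connect1 _); rewrite /avoiding xv yv.
Qed.

Lemma component_exit v p x : undirected T v p -> x \in component T v p -> undirected T x v -> x = p.
Proof.
move=> vp xp xv; symmetry; apply: (neighbors_separated vp); first by rewrite undirected_sym.
by rewrite -in_component.
Qed.

(** The path from [z] to [w] turns at [v] for the first time, so that [v] is
comparable to [z]; it enters [v] from [p] and leaves it towards [q]. *)
Definition turns_at z w v p q : Prop :=
  [/\ p != q, z \in component T v p, w \in component T v q &
    [/\ T v p, T v q & connect T p z] \/ [/\ T p v, T q v & connect T z p]].

(** Induction on the path: when it passes from a node [u] comparable to [z] to a
node incomparable to [z], it turns at [u]; later it cannot come back to the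
turning node, which is comparable to [z]. *)
Lemma first_turn z w : ~~ connect T z w -> ~~ connect T w z ->
  exists v p q, turns_at z w v p q.
Proof.
pose P u := [\/ connect T z u, connect T u z | exists v p q, turns_at z u v p q].
suff : P w by case=> [->|->|].
have [asym conn _] := treeT.
apply: (connect_ind (P := P) _ _ (conn z w)); last exact/Or31/connect0.
move=> u x _ ux Pu.
case: (boolP (connect T z x)) => [zx|nzx]; first exact: Or31.
case: (boolP (connect T x z)) => [xz|nxz]; first exact: Or32.
apply: Or33; case: Pu => [zu|uz|[v [p [q [pq zp uq cmp]]]]].
- have xu : T x u.
    by case/orP: ux => // ux; rewrite (connect_trans zu (connect1 ux)) in nzx.
  have neq : z != u by apply: contraNneq nxz => ->; apply: connect1.
  have [p zp pu] := connect_last zu neq; exists u, p, x; split.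
  + by apply: contraNneq nzx => <-.
  + by apply: connect_component_rev; rewrite ?(tree_acyclic pu).
  + exact: mem_component.
  + by right.
- have xu : T u x.
    by case/orP: ux => // xu; rewrite (connect_trans (connect1 xu) uz) in nxz.
  have neq : u != z by apply: contraNneq nzx => <-; apply: connect1.
  have [p up pz] := connect_first uz neq; exists u, p, x; split.
  + by apply: contraNneq nxz => <-.
  + by apply: connect_component; rewrite ?(tree_acyclic up).
  + exact: mem_component.
  + by left.
- exists v, p, q; split=> //; apply: component_closed ux _ => //.
    by case: cmp => -[h1 h2 _]; [rewrite eq_sym|]; apply: tree_neq.
  case: cmp => -[vp vq pz]; apply: contraTneq isT => xv; subst x.
    by rewrite (connect_trans (connect1 vp) pz) in nxz.
  by rewrite (connect_trans pz (connect1 vp)) in nzx.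
Qed.

Lemma turn_comparable z w v p q : turns_at z w v p q -> connect T v z || connect T z v.
Proof.
case=> _ _ _ [[vp _ pz]|[pv _ zp]]; first by rewrite (connect_trans (connect1 vp) pz).
by rewrite (connect_trans zp (connect1 pv)) orbT.
Qed.

(** The only exit from the subtree above [p] is the edge coming from [v]. *)
Lemma component_up_closed v p x y : T v p -> x \in component T v p -> connect T x y ->
  y \in component T v p.
Proof.
move=> vp xp; apply: (connect_ind (P := fun y => y \in component T v p)) => // u w _ uw up.
have vp' : undirected T v p by rewrite /undirected vp.
have uw' : undirected T u w by rewrite /undirected uw.
apply: (component_closed _ up uw'); first by rewrite eq_sym tree_neq.
apply: contraTneq uw => wv; rewrite wv in uw' *; rewrite (component_exit vp' up uw').
by have [asym _ _] := treeT; apply: asym.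
Qed.

Lemma component_enter v p x y : T v p -> x \in component T v p -> connect T y x ->
  y \notin component T v p -> connect T y v.
Proof.
move=> vp xp; rewrite -(connect_opp T) => xy /negP ny.
suff : y \in component T v p \/ connect T y v by case.
move: xy; apply: (connect_ind (P := fun y => y \in component T v p \/ connect T y v)); last by left.
move=> u w _ wu [up|uv]; last first.
  by right; apply: (@connect_trans _ T u w v) uv; apply: connect1.
case: (eqVneq w v) => [->|wv]; [by right|left].
apply: (component_closed _ up _ wv); first by rewrite eq_sym tree_neq.
by rewrite /undirected [T w u]wu orbT.
Qed.

Lemma component_avoid v p x w : x \in component T v p -> w \notin component T v p ->
  connect (avoiding T w) p x.
Proof.
move=> xp wp; rewrite in_component in xp; apply: (sub_connect_ind xp) => y z py yz _.
have py' : y \in component T v p by rewrite in_component.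
have pz' : z \in component T v p by rewrite in_component (connect_trans py (connect1 yz)).
rewrite /avoiding; case/and3P: yz => _ _ ->; rewrite andbT.
by apply/andP; split; apply: contraNneq wp => <-.
Qed.

End DirectedTree.

(** * Separating trees *)

Section SeparatingTree.
Variable T : rel 'I_n.
Hypothesis sepT : separating_tree T.

Let treeT : directed_tree T. Proof. by case: sepT. Qed.

Lemma separatedE v L R x y : separated_by v L R -> x \in L -> y \in R -> x < v < y.
Proof.
case/andP=> /forall_inP lL /forall_inP lR xL yR.
have /forall_inP -> := lL x xL; last exact: set11.
by have /forall_inP -> := lR v (set11 v).
Qed.

Lemma parents_separated v p q x y : T v p -> T v q -> p != q ->
  x \in component T v p -> y \in component T v q -> (x < v < y) || (y < v < x).
Proof.
move=> vp vq pq xp yq; have [_ _ sep _] := sepT.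
have := sep v p q; rewrite !inE => /(_ vp vq pq) /orP[] /separatedE sE.
  by rewrite (sE x y).
by rewrite orbC (sE y x).
Qed.

Lemma children_separated v p q x y : T p v -> T q v -> p != q ->
  x \in component T v p -> y \in component T v q -> (x < v < y) || (y < v < x).
Proof.
move=> vp vq pq xp yq; have [_ _ _ sep] := sepT.
have := sep v p q; rewrite !inE => /(_ vp vq pq) /orP[] /separatedE sE.
  by rewrite (sE x y).
by rewrite orbC (sE y x).
Qed.

Lemma turn_separated z w v p q : turns_at T z w v p q -> (z < v < w) || (w < v < z).
Proof.
case=> pq zp wq [[vp vq _]|[vp vq _]]; first exact: parents_separated pq zp wq.
exact: children_separated pq zp wq.
Qed.

Lemma parent_of_two v p q r : T v p -> T v q -> p != q -> T v r -> r = p \/ r = q.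
Proof.
move=> vp vq pq vr; case: (eqVneq r p) => [|rp]; first by left.
case: (eqVneq r q) => [|rq]; first by right.
have [_ /(_ v) [card2 _] _ _] := sepT.
suff : 2 < #|parents T v| by rewrite ltnNge card2.
have sub : r |: [set p; q] \subset parents T v.
  by apply/subsetP=> x; rewrite !inE => /orP[/eqP ->|/orP[/eqP ->|/eqP ->]].
by apply: leq_trans (subset_leq_card sub); rewrite cardsU1 cards2 pq !inE negb_or rp rq.
Qed.

(** A point strictly between the ends of an edge that is comparable to neither of
them would be on the other side of a node from both. *)
Lemma edge_comparable x y z : undirected T x y -> x < z < y ->
  [|| connect T z x, connect T z y, connect T x z | connect T y z].
Proof.
move=> xy /andP[xz zy]; apply: contraT; rewrite !negb_or => /and4P[zx nzy nxz yz].
have [v [p [q tn]]] := first_turn treeT zx nxz.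
have vy : y != v.
  by apply: contraTneq (turn_comparable tn) => <-; rewrite negb_or yz.
have tn' : turns_at T z y v p q.
  case: tn => pq zp xq cmp; split=> //; apply: (component_closed _ xq xy vy).
  by case: cmp => -[h1 h2 _]; [rewrite eq_sym|]; apply: (tree_neq treeT).
have := turn_separated tn; have := turn_separated tn'; lia.
Qed.

(** If [c] were not below [v], the first turn of its path towards [x] would
separate it from the connected set formed by [v] and its two ancestor subtrees,
which contains points on both sides of [c]. *)
Lemma between_parents v p q x y c : T v p -> T v q -> p != q ->
  x \in component T v p -> y \in component T v q -> x < c < y ->
  c \notin component T v p -> c \notin component T v q -> connect T c v.
Proof.
move=> vp vq pq xp yq /andP[xc cy] ncp ncq.
case: (boolP (connect T c x)) => [cx|ncx]; first exact: (component_enter treeT vp xp cx).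
case: (boolP (connect T x c)) => [xc'|nxc].
  by rewrite (component_up_closed treeT vp xp xc') in ncp.
have [w [p1 [q1 tn]]] := first_turn treeT ncx nxc.
have inside r z : T v r -> z \in component T v r -> w \in component T v r ->
    c \notin component T v r -> connect T c v.
  move=> vr zr wr ncr; case/orP: (turn_comparable tn) => [wc|cw].
    by rewrite (component_up_closed treeT vr wr wc) in ncr.
  exact: (component_enter treeT vr wr cw).
case: (boolP (w \in component T v p)) => [wp|nwp]; first exact: (inside p x).
case: (boolP (w \in component T v q)) => [wq|nwq]; first exact: (inside q y).
case: (eqVneq w v) => [wv|wv].
  rewrite wv in tn; case: (tn) => _ cp1 _ [[vp1 _ _]|[pv _ cp]].
    by case: (parent_of_two vp vq pq vp1) => eqp; rewrite -eqp cp1 in ncp ncq.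
  exact: connect_trans cp (connect1 pv).
have cxy : connect (avoiding T w) x y.
  have xp' : connect (avoiding T w) x p.
    by rewrite (avoiding_connect_sym T w); apply: component_avoid xp nwp.
  apply: connect_trans xp' _; apply: connect_trans (component_avoid yq nwq).
  have pw : p != w by apply: contraNneq nwp => <-; apply: mem_component.
  have qw : q != w by apply: contraNneq nwq => <-; apply: mem_component.
  by apply: (@connect_trans _ _ v); apply: connect1;
    rewrite /avoiding /undirected [v == w]eq_sym wv ?pw ?qw ?vp ?vq ?orbT.
have tn' : turns_at T c y w p1 q1.
  case: tn => h1 h2 h3 h4; split=> //; rewrite !in_component in h3 *.
  exact: connect_trans h3 cxy.
by move: (turn_separated tn) (turn_separated tn') xc cy; clear; lia.
Qed.

End SeparatingTree.
End Trees.

(** * Linear extensions of a separating tree *)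

Section LinearExtensions.
Variable n : nat.
Implicit Types (T r : rel 'I_n) (x y z u v w p q i j k c l : 'I_n) (a b f m : arc n).
Implicit Types (s t : 'S_n) (e : rel 'S_n).

Lemma linear_extensionP r s :
  reflect (forall x y, r x y -> x != y -> before s x y) (linear_extension r s).
Proof.
apply: (iffP forallP) => [H x y rxy neq|H x].
  have /forallP/(_ y)/implyP/(_ rxy) := H x.
  rewrite leq_eqVlt => /orP[/eqP/val_inj/perm_inj eq|//].
  by rewrite eq eqxx in neq.
apply/forallP=> y; apply/implyP=> rxy; case: (eqVneq x y) => [-> //|neq].
exact/ltnW/H.
Qed.

Definition tree_extension T s := linear_extension (connect T) s.

Lemma tree_extension_rev T s : tree_extension (opp T) (rev_perm s) = tree_extension T s.
Proof.
apply/linear_extensionP/linear_extensionP => H x y xy neq.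
  by rewrite -before_rev; apply: H; rewrite ?(connect_opp T) // eq_sym.
by rewrite before_rev; apply: H; rewrite -?(connect_opp T) // eq_sym.
Qed.

Lemma mandatory_opp T a : mandatory (opp T) (flip_arc a) = mandatory T a.
Proof.
rewrite /mandatory (undirected_opp T); congr (_ && _).
rewrite andbC /arc_A /arc_B /=; congr (_ && _).
  by rewrite -/(arc_A a); congr (_ == _); apply/setP=> c; rewrite !inE !(connect_opp T).
by rewrite -/(arc_B a); congr (_ == _); apply/setP=> c; rewrite !inE !(connect_opp T).
Qed.

Lemma forbidden_down_opp T a : forbidden_up (opp T) (flip_arc a) = forbidden_down T a.
Proof.
rewrite /forbidden_up /forbidden_down; congr (_ && _).
  by rewrite /is_up_arc /is_down_arc /arc_A /arc_B /= andbC.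
apply: eq_existsb => j; have -> // : ancestor_subtrees (opp T) j = descendant_subtrees T j.
rewrite /ancestor_subtrees /descendant_subtrees (parents_opp T).
by apply: eq_imset => p; rewrite (component_opp T).
Qed.

Section Tree.
Variable T : rel 'I_n.
Hypothesis sepT : separating_tree T.

Let treeT : directed_tree T. Proof. by case: sepT. Qed.

(** By [edge_comparable] and acyclicity, a point between the ends of an edge is either
below or above the edge, so that the mandatory arc of the edge is well defined. *)
Lemma edge_side x y c : undirected T x y -> x < c < y ->
  connect T x c || connect T y c = ~~ (connect T c x || connect T c y).
Proof.
move=> xy /andP[xc cy]; have := edge_comparable sepT xy; move/(_ c); rewrite xc cy => /(_ isT).
have cx : c != x by rewrite -val_eqE /= gtn_eqF.
have ncy : c != y by rewrite -val_eqE /= ltn_eqF.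
have A u : c != u -> ~~ (connect T c u && connect T u c).
  by apply: contraNN => /andP[h1 h2]; apply/eqP; apply: (tree_anti treeT).
have B u w : undirected T u w -> c != u -> c != w -> ~~ (connect T c u && connect T w c).
  move=> uw cu cw; apply/negP => /andP[h1 h2]; case/orP: uw => [uw|wu].
    by have := tree_acyclic treeT uw; rewrite (connect_trans h2 h1).
  by case: (tree_cover treeT wu h2 h1) => eqc; rewrite eqc eqxx in cu cw.
have := A x cx; have := A y ncy; have := B x y xy cx ncy.
have := B y x; rewrite undirected_sym => /(_ xy ncy cx).
by case: (connect T c x); case: (connect T c y); case: (connect T x c); case: (connect T y c).
Qed.

Lemma mandatory_exists x y : undirected T x y -> x < y ->
  exists a, [/\ mandatory T a, arc_src a = x & arc_tgt a = y].
Proof.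
move=> xy lt; exists (cut_arc lt (fun c => connect T c x || connect T c y)); split=> //.
rewrite /mandatory xy eqxx /=; apply/eqP/setP=> c; rewrite !inE.
by case: (boolP (x < c < y)) => //= /(edge_side xy) ->.
Qed.

(** Sort the points by [key], then by the number of points below them. *)
Lemma extension_exists (key : 'I_n -> nat) :
  (forall x y, connect T x y -> key x <= key y) ->
  exists2 s, tree_extension T s & forall x y, key x < key y -> before s x y.
Proof.
move=> keyP; pose h z := #|[set w | connect T w z]|.
have hP x y : connect T x y -> x != y -> h x < h y.
  move=> xy neq; apply/proper_card/properP; split.
    by apply/subsetP=> z; rewrite !inE => zx; apply: connect_trans zx xy.
  exists y; rewrite !inE //; apply: contra neq => yx.
  by apply/eqP; apply: (tree_anti treeT).
pose R x y := (key x < key y) || (key x == key y) &&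
  ((h x < h y) || (h x == h y) && (x < y)).
have [s sE] : exists s, before s =2 R.
  apply: perm_of_order => [x|y x z|x y]; rewrite /R; [lia|lia|].
  rewrite -val_eqE /=; lia.
exists s => [|x y lt]; last by rewrite sE /R lt.
apply/linear_extensionP=> x y xy neq; rewrite sE /R.
by have := keyP _ _ xy; have := hP _ _ xy neq; lia.
Qed.

(** List [D], then [x], then [y], then the remaining points. *)
Lemma extension_adjacent x y (D : pred 'I_n) : x != y ->
  (forall u w, connect T u w -> D w -> D u) -> ~~ D x -> ~~ D y ->
  (forall u, connect T u x -> u != x -> D u) ->
  (forall u, connect T u y -> u != y -> u != x -> D u) ->
  exists s, [/\ tree_extension T s, before s x y, forall c, before s x c -> ~~ before s c y &
    forall c, c != x -> c != y -> before s c y = D c].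
Proof.
move=> xy Ddown nDx nDy Dx Dy.
pose key z := if D z then 0 else if z == x then 1 else if z == y then 2 else 3.
have kx : key x = 1 by rewrite /key (negPf nDx) eqxx.
have ky : key y = 2 by rewrite /key (negPf nDy) eq_sym (negPf xy) eqxx.
have kD c : D c -> key c = 0 by rewrite /key => ->.
have kN c : c != x -> c != y -> ~~ D c -> key c = 3.
  by rewrite /key => /negPf -> /negPf -> /negPf ->.
have [] := @extension_exists key.
  move=> u w uw; case: (boolP (D u)) => [/kD -> //|nDu].
  have nDw : ~~ D w by apply: contra nDu; apply: Ddown.
  case: (eqVneq u w) => [-> //|neq].
  case: (eqVneq w x) => [ewx|wx]; first by rewrite Dx -?ewx in nDu.
  case: (eqVneq w y) => [ewy|wy]; last by rewrite (kN _ wx wy nDw) /key; do !case: ifP.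
  case: (eqVneq u x) => [->|ux]; first by rewrite kx ewy ky.
  by rewrite Dy -?ewy in nDu.
move=> s ext sK.
have sD c : c != x -> c != y -> before s c x = D c /\ before s c y = D c.
  move=> cx cy; case: (boolP (D c)) => [Dc|nDc].
    by split; apply: sK; rewrite (kD _ Dc) ?kx ?ky.
  by split; apply/negbTE; rewrite -before_neg 1?eq_sym //; apply: sK;
    rewrite (kN _ cx cy nDc) ?kx ?ky.
exists s; split=> // [|c xc|c cx cy]; first by apply: sK; rewrite kx ky.
  apply/negP => cy; have [] := sD c _ (before_neq cy); first by rewrite eq_sym (before_neq xc).
  by rewrite (before_asym xc) cy => <-.
by have [] := sD c cx cy.
Qed.

(** List first the other points below [y]. *)
Lemma edge_adjacent x y : T x y ->
  exists s, [/\ tree_extension T s, before s x y, forall c, before s x c -> ~~ before s c y &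
    forall c, c != x -> c != y -> before s c y = connect T c x || connect T c y].
Proof.
move=> xy; have neq := tree_neq treeT xy.
have [] := @extension_adjacent x y (fun z => [&& connect T z y, z != x & z != y]) neq.
- move=> u w uw /and3P[wy wx wy']; have uy := connect_trans uw wy; rewrite uy /=.
  apply/andP; split.
    apply: contraNneq wx => eux; rewrite eux in uw.
    by case: (tree_cover treeT xy uw wy) => [->//|ewy]; rewrite ewy eqxx in wy'.
  by apply: contraNneq wy' => euy; rewrite euy in uw; apply/eqP; apply: (tree_anti treeT).
- by rewrite eqxx andbF.
- by rewrite eqxx !andbF.
- move=> u ux neqx; rewrite neqx (connect_trans ux (connect1 xy)) /=.
  by apply: contraTneq ux => ->; rewrite (tree_acyclic treeT xy).
- by move=> u -> -> ->.
move=> s [ext bxy adj sD]; exists s; split=> // c cx cy.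
rewrite sD // cx cy !andbT; apply/idP/orP => [->|[cx'|//]]; first by right.
exact: connect_trans cx' (connect1 xy).
Qed.

(** A mandatory arc labels a step out of the set of linear extensions: exchange
the ends of the edge in a linear extension where they are adjacent. *)
Lemma mandatory_step a : mandatory T a ->
  exists s t, arc_step a s t /\ tree_extension T s != tree_extension T t.
Proof.
case/and3P=> edge /eqP Aeq _; have lt := arc_lt a.
have AE c : arc_src a < c < arc_tgt a ->
    (c \in arc_A a) = connect T c (arc_src a) || connect T c (arc_tgt a).
  by move=> ct; rewrite Aeq !inE ct.
have cneq c : arc_src a < c < arc_tgt a -> (c != arc_src a) /\ (c != arc_tgt a).
  by rewrite -!val_eqE /=; lia.
have out s x y : T x y -> before s y x -> tree_extension T s = false.
  move=> xy yx; apply/negP => /linear_extensionP/(_ _ _ (connect1 xy) (tree_neq treeT xy)).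
  by rewrite (before_asym yx).
case/orP: edge => [ik|ki].
  have [s [ext bik adj sA]] := edge_adjacent ik.
  have [b [t [tE]]] := step_exists bik adj; rewrite lt => -[bi bk st].
  suff eqb : b = a.
    by rewrite eqb in st; exists s, t; rewrite ext (out t _ _ ik (step_before st)).
  apply: arc_ext => // c; rewrite bi bk => ct; have [ci ck] := cneq c ct.
  by case: st => _ _ ->; rewrite ?bi ?bk // sA ?AE.
have [s [ext bki adj sA]] := edge_adjacent ki.
have [b [t [tE]]] := step_exists bki adj; rewrite ltnNge ltnW //= => -[bi bk st].
suff eqb : b = a.
  by rewrite eqb in st; exists t, s; rewrite ext (out t _ _ ki) //; case: st.
apply: arc_ext => // c; rewrite bi bk => ct; have [ci ck] := cneq c ct.
case: (st) => _ _ ->; rewrite ?bi ?bk // -bk -(step_src st) ?bi ?bk //.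
by rewrite tE !xpair_eqE (negPf ci) (negPf ck) /= andbT sA // AE // orbC.
Qed.

(** Exchanging adjacent values of a linear extension yields a linear extension
unless these values are comparable, and then they are joined by an edge. *)
Lemma extension_step_mandatory a s t : arc_step a s t -> tree_extension T s ->
  ~~ tree_extension T t -> mandatory T a.
Proof.
move=> st exts nextt; have [bik tE sA] := st.
have ext_s x y : connect T x y -> x != y -> before s x y := linear_extensionP _ _ exts x y.
have neq : arc_src a != arc_tgt a by rewrite -val_eqE /= ltn_eqF ?arc_lt.
have cik : connect T (arc_src a) (arc_tgt a).
  apply: contraNT nextt => nik; apply/linear_extensionP => x y xy xny.
  rewrite tE (ext_s x y xy xny) /=; apply/orP; right.
  by apply: contraNneq nik => -[<- <-].
have ik : T (arc_src a) (arc_tgt a).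
  have [z iz zk] := connect_first cik neq.
  case: (eqVneq z (arc_tgt a)) => [<- //|zk'].
  have zi : z != arc_src a by rewrite eq_sym (tree_neq treeT).
  have := ext_s _ _ zk zk'; rewrite -(step_src st zi zk') before_asym //.
  by rewrite ext_s ?connect1 // eq_sym.
have uik : undirected T (arc_src a) (arc_tgt a) by rewrite /undirected ik.
have AE c : arc_src a < c < arc_tgt a ->
    (c \in arc_A a) = connect T c (arc_src a) || connect T c (arc_tgt a).
  move=> ct; rewrite sA //.
  have [ci ck] : c != arc_src a /\ c != arc_tgt a by rewrite -!val_eqE /=; lia.
  case: (boolP (_ || _)) => [/orP[h|h]|].
  - by rewrite -(step_src st) // ext_s.
  - by rewrite ext_s.
  - rewrite -edge_side // => h; apply/negbTE; case/orP: h => h.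
      by rewrite -(step_src st) // -before_neg 1?eq_sym // ext_s // eq_sym.
    by rewrite -before_neg 1?eq_sym // ext_s // eq_sym.
apply/and3P; split=> //; apply/eqP/setP=> c; rewrite !inE.
  by case: (boolP (_ < c < _)) => [/AE -> //|]; apply: contraNF => /in_arc_A_between.
case: (boolP (_ < c < _)) => [ct|]; last by apply: contraNF => /in_arc_B_between.
by rewrite in_arc_B // AE // edge_side.
Qed.

Lemma forbidden_upE a : forbidden_up T a ->
  exists v p q, [/\ T v p, T v q, p != q, arc_src a < v < arc_tgt a &
    [/\ is_max (component T v p) (arc_src a), is_min (component T v q) (arc_tgt a) & is_up_arc a]].
Proof.
case/andP=> up /existsP[v /existsP[L /andP[/imsetP[p]]]].
rewrite inE => vp -> /existsP[R /andP[/imsetP[q]]]; rewrite inE => vq ->.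
case/and3P=> /forall_inP lt mx mn.
have ltpq : p < q.
  by have /forall_inP := lt p (mem_component T v p); apply; apply: mem_component.
have pq : p != q by rewrite -val_eqE /= ltn_eqF.
exists v, p, q; split=> //.
have /andP[mxp _] := mx; have /andP[mnq _] := mn; have := arc_lt a.
have := parents_separated sepT vp vq pq mxp mnq; lia.
Qed.

Lemma up_arcE a c : is_up_arc a -> arc_src a < c < arc_tgt a -> c \in arc_A a.
Proof. by case/andP=> /eqP -> _; rewrite inE. Qed.

(** By [between_parents], the points between the ends of a forbidden up arc lie
below its node [v]: list first all the points below [v] or strictly below one of
the ends, then the two ends, which are incomparable. *)
Lemma forbidden_up_step a : forbidden_up T a ->
  exists s t, [/\ arc_step a s t, tree_extension T s & tree_extension T t].
Proof.
case/forbidden_upE=> v [p [q [vp vq pq /andP[lv vr] [maxl minr up]]]].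
case/andP: maxl minr => lp /forall_inP lmax /andP[rq /forall_inP rmin].
set l := arc_src a in lv lp lmax *; set r := arc_tgt a in vr rq rmin *.
have lr : l < r := arc_lt a.
have neq : l != r by rewrite -val_eqE /= ltn_eqF.
have disj x : x \in component T v p -> x \in component T v q -> False.
  rewrite !in_component => xp xq; case/eqP: pq.
  apply: (neighbors_separated treeT (v := v)); rewrite /undirected ?vp ?vq //.
  by apply: connect_trans xp _; rewrite avoiding_connect_sym.
have nv u x : T v u -> x \in component T v u -> connect T x v = false.
  move=> vu xu; apply/negP => /(component_up_closed treeT vu xu).
  by move/(component_neq _) => h; have := h; rewrite eq_sym (tree_neq treeT vu) eqxx => /(_ isT).
have nlr : connect T l r = false.
  by apply/negP => /(component_up_closed treeT vp lp) /disj; apply.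
have nrl : connect T r l = false.
  by apply/negP => /(component_up_closed treeT vq rq); apply: disj.
pose D z := [|| connect T z v, connect T z l && (z != l) | connect T z r && (z != r)].
have [] := @extension_adjacent l r D neq.
- have strict u w x : connect T u w -> connect T w x && (w != x) -> connect T u x && (u != x).
    move=> uw /andP[wx neqwx]; rewrite (connect_trans uw wx) /=.
    by apply: contraNneq neqwx => eux; rewrite eux in uw; apply/eqP; apply: (tree_anti treeT).
  move=> u w uw /or3P[h|h|h]; rewrite /D.
  + by rewrite (connect_trans uw h).
  + by rewrite (strict u w l) // orbT.
  + by rewrite (strict u w r) // !orbT.
- by rewrite /D (nv p) // eqxx andbF nlr.
- by rewrite /D (nv q) // eqxx andbF nrl.
- by move=> u ul neqz; rewrite /D ul neqz orbT.
- by move=> u ur neqz _; rewrite /D ur neqz !orbT.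
move=> s [ext blr adj sD].
have [b [t [tE]]] := step_exists blr adj; rewrite lr => -[bl br st].
suff eqb : b = a.
  rewrite eqb in st; exists s, t; split=> //; apply/linear_extensionP => x y xy xny.
  rewrite tE (linear_extensionP _ _ ext) //=; apply/orP; right.
  by apply: contraTneq xy => -[-> ->]; rewrite nlr.
apply: arc_ext => // c; rewrite bl br => ct.
rewrite (up_arcE up) //; case: st => _ _ ->; rewrite ?bl ?br //.
have [cl cr] : c != l /\ c != r.
  by case/andP: ct => lc cr; rewrite -!val_eqE /= gtn_eqF ?ltn_eqF.
case/andP: (ct) => lc cr'; rewrite sD // /D (between_parents sepT vp vq pq lp rq) //.
  by apply/negP => /lmax; rewrite leqNgt lc.
by apply/negP => /rmin; rewrite leqNgt cr'.
Qed.

End Tree.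
End LinearExtensions.

Section ClassesOfTrees.
Variable n : nat.
Implicit Types (T r : rel 'I_n) (x y z u v w p q i j k c l : 'I_n) (a b f m : arc n).
Implicit Types (s t : 'S_n) (e : rel 'S_n) (G : {set arc n}).

Definition forbidden T a : bool := forbidden_up T a || forbidden_down T a.

Lemma extension_step_edge T a s t : separating_tree T -> arc_step a s t ->
  tree_extension T s != tree_extension T t -> mandatory T a.
Proof.
move=> sepT st; case: (boolP (tree_extension T s)) => [exts|nexts].
  by rewrite eq_sym eqb_id; apply: (extension_step_mandatory sepT st exts).
rewrite eq_sym eqbF_neg negbK => extt.
rewrite -mandatory_opp; apply: (extension_step_mandatory (separating_tree_opp sepT) (step_rev st));
  by rewrite tree_extension_rev.
Qed.

Lemma forbidden_step T a : separating_tree T -> forbidden T a ->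
  exists s t, [/\ arc_step a s t, tree_extension T s & tree_extension T t].
Proof.
move=> sepT /orP[/(forbidden_up_step sepT) //|].
rewrite -forbidden_down_opp => /(forbidden_up_step (separating_tree_opp sepT)).
case=> s [t [st exts extt]].
exists (rev_perm t), (rev_perm s); split.
- by rewrite -[a]flip_arcK; apply: step_rev.
- by rewrite -tree_extension_rev rev_permK.
- by rewrite -tree_extension_rev rev_permK.
Qed.

Lemma max_exists (L : {set 'I_n}) x : x \in L -> exists2 y : 'I_n, x <= y & is_max L y.
Proof.
move=> xL; case: (arg_maxnP (fun y : 'I_n => nat_of_ord y) xL) => y yL ymax.
by exists y; [exact: ymax|apply/andP; split=> //; apply/forall_inP => z; apply: ymax].
Qed.

Lemma min_exists (L : {set 'I_n}) x : x \in L -> exists2 y : 'I_n, y <= x & is_min L y.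
Proof.
move=> xL; case: (arg_minnP (fun y : 'I_n => nat_of_ord y) xL) => y yL ymin.
by exists y; [exact: ymin|apply/andP; split=> //; apply/forall_inP => z; apply: ymin].
Qed.

(** The node [v], being below the source of [a], stands before it, hence also before
the target, which is adjacent to the source; so do the points in the gap between
the two ancestor subtrees of [v], since they lie below [v]. *)
Lemma turn_forbidden_up T a s t v p q : separating_tree T -> arc_step a s t ->
  tree_extension T s -> T v p -> T v q -> p != q -> connect T p (arc_src a) ->
  arc_src a \in component T v p -> arc_tgt a \in component T v q ->
  exists2 f, forbidden_up T f & subarc f a.
Proof.
move=> sepT st /linear_extensionP ext vp vq pq pi ip kq; have [treeT _ _ _] := sepT.
have lt := arc_lt a; have [bik _ sA] := st.
have sep x y : x \in component T v p -> y \in component T v q -> x < v < y.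
  move=> xp yq; have := parents_separated sepT vp vq pq xp kq.
  have := parents_separated sepT vp vq pq ip yq; have := parents_separated sepT vp vq pq ip kq.
  by move: lt; clear; lia.
have [l il lmax] := max_exists ip; have [r rk rmin] := min_exists kq.
have /andP[lp /forall_inP lle] := lmax; have /andP[rq /forall_inP rle] := rmin.
have /andP[lv vr] := sep l r lp rq; have lr := ltn_trans lv vr.
have up : is_up_arc (cut_arc lr predT).
  apply/andP; split; apply/eqP/setP=> c; first by rewrite !inE andbT.
  by rewrite !inE andbF.
exists (cut_arc lr predT).
  rewrite /forbidden_up up /=; apply/existsP; exists v.
  apply/existsP; exists (component T v p); rewrite imset_f ?inE //=.
  apply/existsP; exists (component T v q); rewrite imset_f ?inE //=.
  rewrite /max_to_min lmax rmin !andbT; apply/forall_inP => x xp; apply/forall_inP => y yq.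
  by have /andP[] := sep x y xp yq; apply: ltn_trans.
apply/subarcP; split=> // c ct; have {}ct : l < c < r := ct.
have ca : arc_src a < c < arc_tgt a by move: ct il rk; clear; lia.
rewrite (up_arcE up ct) sA //.
have cv : connect T c v.
  apply: (between_parents sepT vp vq pq lp rq ct); apply/negP; [move/lle|move/rle];
  by move: ct; clear; lia.
have vi : connect T v (arc_src a) := connect_trans (connect1 vp) pi.
have ci : c != arc_src a by move: ca; clear; rewrite -val_eqE /=; lia.
by symmetry; apply: before_trans bik; apply: ext ci; apply: connect_trans cv vi.
Qed.

(** The exchanged values are incomparable; apply [turn_forbidden_up] or its dual
to the first turn of the path between them. *)
Lemma extension_step_forbidden T a s t : separating_tree T -> arc_step a s t ->
  tree_extension T s -> tree_extension T t -> exists2 f, forbidden T f & subarc f a.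
Proof.
move=> sepT st exts extt; have [treeT _ _ _] := sepT.
have neq : arc_src a != arc_tgt a by rewrite -val_eqE /= ltn_eqF ?arc_lt.
have nik : ~~ connect T (arc_src a) (arc_tgt a).
  by apply/negP => /(linear_extensionP _ _ extt) /(_ neq); rewrite (before_asym (step_before st)).
have nki : ~~ connect T (arc_tgt a) (arc_src a).
  rewrite eq_sym in neq; apply/negP => /(linear_extensionP _ _ exts) /(_ neq).
  by case: (st) => /before_asym ->.
have [v [p [q [pq ip kq [[vp vq pi]|[pv qv ip']]]]]] := first_turn treeT nik nki.
  have [f fup fa] := turn_forbidden_up sepT st exts vp vq pq pi ip kq.
  by exists f => //; rewrite /forbidden fup.
have [||||f fup fa] := @turn_forbidden_up (opp T) (flip_arc a) _ _ v p q
  (separating_tree_opp sepT) (step_rev st) _ pv qv pq.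
- by rewrite tree_extension_rev.
- by rewrite (connect_opp T).
- by rewrite (component_opp T).
- by rewrite (component_opp T).
exists (flip_arc f); last by rewrite -subarc_flip flip_arcK.
by rewrite /forbidden -forbidden_down_opp flip_arcK fup orbT.
Qed.

(** If the node [v] of a forbidden up arc lies below an end of the edge of a
mandatory arc, then both ends of this edge lie in the same ancestor subtree of
[v], and the edge cannot pass over the gap between the two subtrees. *)
Lemma forbidden_up_not_mandatory T f m : separating_tree T -> forbidden_up T f -> mandatory T m ->
  ~~ subarc f m.
Proof.
move=> sepT /(forbidden_upE sepT) [v [p [q [vp vq pq lvr [lmax rmin up]]]]] /and3P[edge /eqP AE _].
have [treeT _ _ _] := sepT.
apply/negP => /and4P[il rk /subsetP/(_ v) sA _].
have /andP[lp /forall_inP lle] := lmax; have /andP[rq /forall_inP rle] := rmin.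
have {sA} : v \in arc_A m by apply: sA; exact: up_arcE.
rewrite AE !inE => /andP[_ vik].
have [lv vr] := andP lvr.
have iv : arc_src m != v by rewrite -val_eqE /= ltn_eqF // (leq_ltn_trans il).
have kv : arc_tgt m != v by rewrite -val_eqE /= gtn_eqF // (leq_trans vr).
have pv : p != v by rewrite eq_sym (tree_neq treeT).
have qv : q != v by rewrite eq_sym (tree_neq treeT).
have above x : x != v -> connect T v x -> x \in component T v p \/ x \in component T v q.
  rewrite eq_sym => xv vx; have [z vz zx] := connect_first vx xv.
  have xz : x \in component T v z by apply: connect_component; rewrite ?(tree_acyclic treeT vz).
  by case: (parent_of_two sepT vp vq pq vz) => <-; [left|right].
have niq : arc_src m \notin component T v q by apply/negP => /rle; move: il lv vr; clear; lia.
have nkp : arc_tgt m \notin component T v p by apply/negP => /lle; move: rk lv vr; clear; lia.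
case/orP: vik => [/(above _ iv) [ip|iq]|/(above _ kv) [kp|kq]].
- by rewrite (component_closed pv ip edge kv) in nkp.
- by rewrite iq in niq.
- by rewrite kp in nkp.
- by rewrite undirected_sym in edge; rewrite (component_closed qv kq edge iv) in niq.
Qed.

Lemma forbidden_not_mandatory T f m : separating_tree T -> forbidden T f -> mandatory T m ->
  ~~ subarc f m.
Proof.
move=> sepT /orP[|fd mm]; first exact: forbidden_up_not_mandatory.
rewrite -subarc_flip; apply: (forbidden_up_not_mandatory (separating_tree_opp sepT)).
  by rewrite forbidden_down_opp.
by rewrite mandatory_opp.
Qed.

(** * Classes whose poset is a given separating tree *)

(** A finite order is the reflexive transitive closure of its cover relation, by
induction on the size of intervals. *)
Lemma poset_hasse_connect r T : poset r -> hasse r =2 T -> r =2 connect T.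
Proof.
case=> refl anti tr hT x y; apply/idP/idP; last first.
  apply: (connect_ind (P := fun y => r x y)) => // u w _; rewrite -hT => /and3P[_ uw _] xu.
  exact: tr xu uw.
have [k] := ubnP #|[set z | r x z && r z y]|; elim: k x y => // k IH x y lk xy.
case: (eqVneq x y) => [-> //|neq].
case: (boolP (T x y)) => [/connect1 //|]; rewrite -hT /hasse neq xy /=.
case/forallPn => z; rewrite negb_imply !inE negb_or => /and3P[/andP[xz zy] zx zy'].
apply: (@connect_trans _ _ z).
  apply: IH => //; rewrite ltnS in lk; apply: leq_trans lk; apply/proper_card/properP.
  split; first by apply/subsetP=> w; rewrite !inE => /andP[-> wz]; rewrite (tr _ _ _ wz zy).
  exists y; rewrite !inE ?xy ?refl //; apply: contra zy' => /andP[_ yz].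
  by apply/eqP/anti; rewrite zy yz.
apply: IH => //; rewrite ltnS in lk; apply: leq_trans lk; apply/proper_card/properP.
split; first by apply/subsetP=> w; rewrite !inE => /andP[zw ->]; rewrite (tr _ _ _ xz zw).
exists x; rewrite !inE ?xy ?refl //; apply: contra zx => /andP[zx' _].
by apply/eqP/anti; rewrite zx' xz.
Qed.

Lemma hasse_connect T : directed_tree T -> hasse (connect T) =2 T.
Proof.
move=> treeT x y; apply/and3P/idP => [[neq xy /forallP cov]|xy].
  have [z xz zy] := connect_first xy neq.
  have := cov z; rewrite (connect1 xz) zy !inE /= => /orP[/eqP ezx|/eqP <- //].
  by rewrite ezx (tree_irr treeT) in xz.
split; [exact: (tree_neq treeT xy)|exact: connect1|].
apply/forallP => z; apply/implyP => /andP[xz zy]; rewrite !inE.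
by case: (tree_cover treeT xy xz zy) => ->; rewrite eqxx ?orbT.
Qed.

Lemma connect_poset T : directed_tree T -> poset (connect T).
Proof.
move=> treeT; split=> [x|x y /andP[xy yx]|y x z]; first exact: connect0.
  exact: (tree_anti treeT).
exact: connect_trans.
Qed.

(** The classes are the connected components of the graph of contracted steps.
The linear extensions of [T] are closed under contracted steps when the
mandatory arcs are not contracted, and they are connected by contracted steps
when the forbidden arcs are contracted. *)
Lemma class_of_tree e T : lattice_congruence e -> separating_tree T ->
  (exists r, congruence_poset e r /\ hasse r =2 T) <->
  (forall m, mandatory T m -> m \in arcs_of e) /\
  (forall f, forbidden T f -> f \notin arcs_of e).
Proof.
move=> ce sepT; have [eqv _ _] := ce; have [treeT _ _ _] := sepT; split.
  case=> r [[posr [s0 s0E]] hT]; have rE := poset_hasse_connect posr hT.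
  have {}s0E t : e s0 t = tree_extension T t.
    by rewrite s0E; apply: eq_forallb => x; apply: eq_forallb => y; rewrite rE.
  split=> [m /(mandatory_step sepT) [s [t [st neq]]]|f /(forbidden_step sepT)].
    apply: contraNT neq; rewrite -(step_congruence ce st) => est; rewrite -!s0E.
    by apply/eqP; apply/idP/idP => h; apply: (eqv_trans eqv h) => //; apply: (eqv_sym eqv).
  case=> s [t [st exts extt]].
  rewrite -(step_congruence ce st); apply: (eqv_trans eqv (t := s0)); last by rewrite s0E.
  by apply: (eqv_sym eqv); rewrite s0E.
case=> mandP forbP; exists (connect T); split; last exact: hasse_connect.
split; first exact: connect_poset.
have [s0 ext0 _] := @extension_exists n T sepT (fun=> 0) (fun _ _ _ => leqnn 0).
exists s0 => t; apply/idP/idP => [e0t|extt].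
  apply: (congruence_ind (P := fun t => tree_extension T t) ce _ e0t ext0) => a s1 s2 st na.
  have /eqP -> // : tree_extension T s1 == tree_extension T s2.
  by apply: contraR na => /(extension_step_edge sepT st) /mandP.
have hullE (u : 'S_n) : in_hull s0 t u -> tree_extension T u.
  move=> hu; apply/linear_extensionP => x y xy neq.
  by apply: hu; [exact: (linear_extensionP _ _ ext0)|exact: (linear_extensionP _ _ extt)].
apply: (hull_ind (P := fun t => e s0 t)) (eqv_refl eqv s0) => u v a /hullE extu /hullE extv st eu.
have nst s1 s2 : tree_extension T s1 -> tree_extension T s2 -> arc_step a s1 s2 -> e s1 s2.
  move=> ext1 ext2 st12; rewrite (step_congruence ce st12).
  have [f ff fa] := extension_step_forbidden sepT st12 ext1 ext2.
  by apply: contra (forbP f ff); apply: (forcing ce fa).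
by apply: (eqv_trans eqv eu); case: st => st; [|apply: (eqv_sym eqv)]; apply: nst st.
Qed.

(** * Simple congruences *)

Lemma simple_contracting e G : ~: arcs_of e = upper_ideal G ->
  (forall a, a \in G -> is_up_arc a || is_down_arc a) -> simple e.
Proof.
move=> eG Gud a; rewrite -in_setC eG inE => /existsP[b /andP[bG ba]] min.
case: (eqVneq b a) => [<-|neq]; first exact: Gud.
have : b \in arcs_of e by apply: min; rewrite /strict_subarc neq.
rewrite -[_ \in _]negbK -in_setC eG => /negP[]; rewrite inE; apply/existsP.
by exists b; rewrite bG subarc_refl.
Qed.

(** Take for [b] a shortest contracted subarc of [a]. *)
Lemma simple_generator e a : simple e -> a \notin arcs_of e ->
  exists b, [/\ subarc b a, b \notin arcs_of e & is_up_arc b || is_down_arc b].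
Proof.
move=> sim na.
pose P b := subarc b a && (b \notin arcs_of e).
have Pa : P a by rewrite /P subarc_refl.
case: (arg_minnP (P := P) (fun b : arc n => arc_tgt b - arc_src b) Pa) => b /andP[ba nb] bmin.
exists b; split=> //; apply: sim nb _ => c /andP[neq cb]; apply: contraT => nc.
have := bmin c; rewrite /P (subarc_trans cb ba) nc => /(_ isT).
case/subarcP: cb => sc tc cA; have := arc_lt c => ltc lec.
case/eqP: neq; apply: arc_ext => //; apply: val_inj => /=; move: sc tc ltc lec; clear; lia.
Qed.

(** * The interval *)

Section Interval.
Variable T : rel 'I_n.
Hypothesis sepT : separating_tree T.

Lemma subarc_mandatory_circ b m : mandatory T m -> subarc b m ->
  b \notin upper_ideal (circ_generators T).
Proof.
move=> mm bm; rewrite inE; apply/negP => /existsP[g /andP[]].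
rewrite inE => /andP[_ /forallP /(_ m)]; rewrite mm /= => /negP ngm gb; apply: ngm.
exact: subarc_trans gb bm.
Qed.

Lemma mem_bullet_generators f : (f \in bullet_generators T) = forbidden T f.
Proof. by rewrite inE. Qed.

Lemma forbidden_up_or_down f : forbidden T f -> is_up_arc f || is_down_arc f.
Proof. by case/orP => /andP[-> _]; rewrite ?orbT. Qed.

Lemma forbidden_circ f : forbidden T f -> f \in circ_generators T.
Proof.
move=> ff; rewrite inE forbidden_up_or_down //=; apply/forallP => m; apply/implyP => mm.
exact: (forbidden_not_mandatory sepT ff mm).
Qed.

Lemma upper_ideal_bullet_circ :
  upper_ideal (bullet_generators T) \subset upper_ideal (circ_generators T).
Proof.
apply/subsetP=> a; rewrite !inE => /existsP[f /andP[]]; rewrite mem_bullet_generators => ff fa.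
by apply/existsP; exists f; rewrite forbidden_circ.
Qed.

(** Some edge of the tree passes between two consecutive points, by connectedness. *)
Lemma basic_subarc_mandatory a : is_basic_arc a -> exists2 m, mandatory T m & subarc a m.
Proof.
move=> /eqP bas; have [[_ conn _] _ _ _] := sepT.
have : [exists x, exists y, [&& undirected T x y, x <= arc_src a & arc_src a < y]].
  apply: contraT => none; have : arc_tgt a <= arc_src a; last by rewrite bas ltnn.
  have path_a := conn (arc_src a) (arc_tgt a).
  apply: (connect_ind (P := fun y => y <= arc_src a)) path_a => // u w _ uw us.
  rewrite leqNgt; apply: contra none => sw.
  by apply/existsP; exists u; apply/existsP; exists w; rewrite uw us.
case/existsP=> x /existsP[y /and3P[xy xa ya]].
have [m [mm ms mt]] := mandatory_exists sepT xy (leq_ltn_trans xa ya).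
exists m => //; apply/subarcP; rewrite ms mt bas; split=> // c.
by rewrite ltnS; case: ltngtP.
Qed.

(** By [class_of_tree], the condition on the left says that the mandatory arcs
belong to the ideal of [e] and the forbidden arcs do not.  For a simple
congruence, an arc is contracted exactly when one of its up or down subarcs is,
so that both halves of this condition are inclusions of ideals. *)
Lemma interval_iff e : lattice_congruence e -> simple e ->
  (essential e /\ (exists r, congruence_poset e r /\ hasse r =2 T)) <->
  (~: upper_ideal (circ_generators T) \subset arcs_of e /\
   arcs_of e \subset ~: upper_ideal (bullet_generators T)).
Proof.
move=> ce sim; have -> := class_of_tree ce sepT; split.
  case=> _ [mandP forbP]; split; apply/subsetP=> a; rewrite in_setC.
    apply: contraR => /(simple_generator sim) [b [ba nb ud]].
    rewrite inE; apply/existsP; exists b; rewrite ba andbT inE ud /=.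
    apply/forallP => m; apply/implyP => /mandP mA; apply: contra nb => bm.
    exact: (forcing ce bm mA).
  move=> aA; rewrite inE; apply/negP => /existsP[f /andP[]].
  rewrite mem_bullet_generators => /forbP nf fa.
  by rewrite (forcing ce fa aA) in nf.
case=> /subsetP circ /subsetP bullet.
have mandP b m : mandatory T m -> subarc b m -> b \in arcs_of e.
  by move=> mm bm; apply: circ; rewrite in_setC (subarc_mandatory_circ mm).
split=> [a /basic_subarc_mandatory [m mm am]|]; first exact: mandP mm am.
split=> [m mm|f ff]; first exact: mandP mm (subarc_refl m).
apply/negP => /bullet; rewrite in_setC inE => /negP[]; apply/existsP; exists f.
by rewrite mem_bullet_generators ff subarc_refl.
Qed.

End Interval.
End ClassesOfTrees.

Theorem proposition3p18 (n : nat) (T : rel 'I_n) :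
  separating_tree T ->
  exists e_circ e_bullet : rel 'S_n,
    [/\ the_congruence_contracting (circ_generators T) e_circ /\ simple e_circ,
        the_congruence_contracting (bullet_generators T) e_bullet /\
          simple e_bullet,
        arcs_of e_circ \subset arcs_of e_bullet &
        forall e : rel 'S_n, lattice_congruence e -> simple e ->
          (essential e /\
           (exists r : rel 'I_n, congruence_poset e r /\ hasse r =2 T)) <->
          (arcs_of e_circ \subset arcs_of e /\
           arcs_of e \subset arcs_of e_bullet)].
Proof.
move=> sepT.
have cc := congr_of_contracting (circ_generators T).
have cb := congr_of_contracting (bullet_generators T).
have [_ eqc _] := cc; have [_ eqb _] := cb.
exists (congr_of (~: upper_ideal (circ_generators T))),
  (congr_of (~: upper_ideal (bullet_generators T))).
have AE G : arcs_of (congr_of (~: upper_ideal G)) = ~: upper_ideal G.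
  by apply: arcs_of_congr_of; apply: arc_ideal_setC_upper.
rewrite !AE; split.
- by split=> //; apply: simple_contracting eqc _ => a; rewrite inE => /andP[].
- split=> //; apply: simple_contracting eqb _ => a; rewrite mem_bullet_generators.
  exact: forbidden_up_or_down.
- by rewrite setCS upper_ideal_bullet_circ.
- by move=> e ce sim; apply: interval_iff.
Qed.
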